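(* Let $n$ and $k$ be integers greater than or equal to $2$. The couple $(n, k)$ is equalizing if and only if either $k \equiv 1, 2 \pmod 4$ and $n \geq k + 1$, or $k \equiv 0, 3 \pmod 4$ and $n \geq k + 2$.
   Context: $B$ is a set with at least two elements. $[n] := \{1,\dots,n\}$ and $\Sigma_n$ is the symmetric group on $[n]$. For $\mathbf{a} \in A^n$ and $\sigma \in \Sigma_n$, write $\mathbf{a}\sigma := (a_{\sigma(1)},\dots,a_{\sigma(n)})$. Functions $f, g \colon A^n \to B$ are equivalent, $f \equiv g$, if there is $\sigma \in \Sigma_n$ with $f(\mathbf{a}) = g(\mathbf{a}\sigma)$ for all $\mathbf{a} \in A^n$. Let $A^r_{\neq}$ be the set of $r$-tuples over $A$ with pairwise distinct entries and $A^\sharp := \bigcup_{r \geq 1} A^r_{\neq}$. The map $\operatorname{ofo} \colon \bigcup_{n \geq 1} A^n \to A^\sharp$ sends a tuple $\mathbf{a}$ to the tuple listing the distinct elements occurring in $\mathbf{a}$ in the order of their first occurrence (i.e., all repetitions are removed, only the first occurrence of each element is kept). A function $f \colon A^n \to B$ is determined by the order of first occurrence if there exists $f^* \colon A^\sharp \to B$ such that $f = f^* \circ \operatorname{ofo}|_{A^n}$. The couple $(n, k)$ is equalizing (equivalence-equalizing for functions determined by the order of first occurrence) if for all $f, g \colon A^n \to B$ with $|A| = k$: if $f$ and $g$ are determined by the order of first occurrence and $f \equiv g$, then $f = g$. *)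

(* Defs.v *)
From mathcomp Require Import all_boot all_fingroup.

Set Implicit Arguments.
Unset Strict Implicit.
Unset Printing Implicit Defensive.

Section FunctionsOfSeveralArguments.

Variables (A B : Type) (n : nat).

Definition tuple_act (a : n.-tuple A) (s : 'S_n) : n.-tuple A :=
  [tuple tnth a (s i) | i < n].

Definition fun_equiv (f g : n.-tuple A -> B) : Prop :=
  exists s : 'S_n, forall a : n.-tuple A, f a = g (tuple_act a s).

End FunctionsOfSeveralArguments.

Section OrderOfFirstOccurrence.

Variable A : eqType.

(* All lengths r >= 1 are taken together, so a single type of nonempty
   repetition-free sequences stands for the union of the sets A^r_{<>}. *)
Definition Asharp : Type := {s : seq A | (0 < size s) && uniq s}.

(* Despite its documentation, [undup] keeps the last occurrence of each
   element, hence the two reversals. *)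
Definition ofo_seq (s : seq A) : seq A := rev (undup (rev s)).

Lemma ofo_seq_rcons (s : seq A) (x : A) :
  ofo_seq (rcons s x) = if x \in s then ofo_seq s else rcons (ofo_seq s) x.
Proof. by rewrite /ofo_seq rev_rcons /= mem_rev; case: ifP; rewrite ?rev_cons. Qed.

Lemma ofo_seq_sharp (s : seq A) :
  0 < size s -> (0 < size (ofo_seq s)) && uniq (ofo_seq s).
Proof.
rewrite /ofo_seq size_rev rev_uniq undup_uniq andbT -(size_rev s).
case: (rev s) => //= x t _; case: ifP => // xt.
by move: xt; rewrite -mem_undup; case: (undup t).
Qed.

Definition ofo (s : seq A) (s_gt0 : 0 < size s) : Asharp :=
  exist _ (ofo_seq s) (ofo_seq_sharp s_gt0).

(* The inner quantification over a proof of [0 < size a] only records that the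
   domain of [ofo] is the set of nonempty tuples; it is no restriction on [a]
   as soon as [0 < n]. *)
Definition determined_by_ofo (B : Type) (n : nat) (f : n.-tuple A -> B) : Prop :=
  exists fstar : Asharp -> B,
    forall (a : n.-tuple A) (a_gt0 : 0 < size a), f a = fstar (ofo a_gt0).

End OrderOfFirstOccurrence.

Definition equalizing (B : Type) (n k : nat) : Prop :=
  forall (A : finType) (f g : n.-tuple A -> B),
    #|A| = k ->
    determined_by_ofo f -> determined_by_ofo g ->
    fun_equiv f g -> f =1 g.

(* Main.v *)
(* Write [f a = F (ofo a)], [g a = G (ofo a)] and [f a = g (a s)]. The set [C] of
   the permutations [d] of [r] letters such that [F w = G (w d)] for every word
   [w] is closed under [x y^-1 z]; the point is to decide whether this forces
   [1] to be in [C] for every [r <= k]. Repeating one letter shows that [C] contains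
   every permutation obtained from [s] by identifying two positions, and, when
   [n = r + 1], nothing else is known about [C].
   Exchanging two neighbours that form a descent of [s] keeps these reductions
   inside [C] as soon as [C] is stable under suitable transpositions. Such
   transpositions come from comparing reductions of [s]: they exist unless [s] is
   the product [tau] of the transpositions of neighbours that covers every position
   except possibly the first one. So every other [s] can be sorted, and [1] is in
   [C].
   The reductions of [tau] all have the same parity, opposite to that of [tau], and
   they generate the even permutations; hence [tau] is harmless if and only if it
   is odd, that is, if [n] is [2] or [3] modulo [4]. If [n >= r + 2], some reduction
   of [s] is harmless. *)
Require Import Defs.
From mathcomp Require Import all_boot all_fingroup.
From mathcomp Require Import zify.

Set Implicit Arguments.
Unset Strict Implicit.
Unset Printing Implicit Defensive.



Lemma mul_permC (T : finType) (s : {perm T}) (x y : T) :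
  (s * tperm (s x) (s y) = tperm x y * s)%g.
Proof. by rewrite -tpermJ conjgE mulKVg. Qed.


(** * Deleting a point from the graph of a permutation *)

Section PointDeletion.
Local Open Scope group_scope.
Variable n : nat.
Implicit Types (j : 'I_n.+1) (s : 'S_n.+1) (d : 'S_n).

(* [perm_del j s] deletes the point [(j, s j)] from the graph of [s] and renumbers
   both axes. *)
Definition perm_del_fun j s (x : 'I_n) : 'I_n :=
  odflt x (unlift (s j) (s (lift j x))).

Lemma perm_del_funE j s x : lift (s j) (perm_del_fun j s x) = s (lift j x).
Proof.
rewrite /perm_del_fun; case: unliftP => [y -> //|/perm_inj e].
by have := neq_lift j x; rewrite e eqxx.
Qed.

Lemma perm_del_fun_inj j s : injective (perm_del_fun j s).
Proof.
move=> x y e; apply: (@lift_inj _ j); apply: (@perm_inj _ s).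
by rewrite -!perm_del_funE e.
Qed.

Definition perm_del j s : 'S_n := perm (@perm_del_fun_inj j s).

Lemma lift_perm_del j s x : lift (s j) (perm_del j s x) = s (lift j x).
Proof. by rewrite permE perm_del_funE. Qed.

Lemma lift_perm_perm_del j s : lift_perm j (s j) (perm_del j s) = s.
Proof.
apply/permP=> x; case: (unliftP j x) => [y ->|->]; last by rewrite lift_perm_id.
by rewrite lift_perm_lift lift_perm_del.
Qed.

Lemma perm_del_unique j s d : (forall x, lift (s j) (d x) = s (lift j x)) -> perm_del j s = d.
Proof. by move=> h; apply/permP=> x; apply: (@lift_inj _ (s j)); rewrite lift_perm_del h. Qed.

Lemma perm_delV j s : (perm_del j s)^-1 = perm_del (s j) s^-1.
Proof.
apply/esym/perm_del_unique => x; rewrite permK.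
by apply: (@perm_inj _ s); rewrite -lift_perm_del permKV permKV.
Qed.

Lemma odd_perm_del j s : odd_perm (perm_del j s) = odd j (+) odd (s j) (+) odd_perm s.
Proof.
have := odd_lift_perm j (s j) (perm_del j s); rewrite lift_perm_perm_del => ->.
by do 2!case: (odd _); case: (odd_perm _).
Qed.

Lemma lift_tperm j (x y z : 'I_n) :
  lift j (tperm x y z) = tperm (lift j x) (lift j y) (lift j z).
Proof. by rewrite inj_tperm //; apply: lift_inj. Qed.

Lemma perm_del_tpermL j s (x y : 'I_n) :
  perm_del j (tperm (lift j x) (lift j y) * s) = tperm x y * perm_del j s.
Proof.
apply: perm_del_unique => z.
have -> : (tperm (lift j x) (lift j y) * s) j = s j.
  by rewrite permM tpermD // eq_sym neq_lift.
by rewrite !permM lift_perm_del lift_tperm.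
Qed.

(** Once one of two neighbouring positions is removed, their order is lost, so exchanging them
    beforehand only changes which of the two is removed. *)
Lemma perm_del_shift j j' s : j' = j.+1 :> nat -> perm_del j (tperm j j' * s) = perm_del j' s.
Proof.
move=> e; apply: perm_del_unique => x; rewrite permM tpermL lift_perm_del permM; congr (s _).
have [ex|nx] := eqVneq (x : nat) j.
  have -> : lift j x = j' by apply: val_inj; rewrite /= /bump; lia.
  by rewrite tpermR; apply: val_inj; rewrite /= /bump; lia.
rewrite tpermD; first by apply: val_inj; rewrite /= /bump; lia.
  exact: neq_lift.
by rewrite -val_eqE /= /bump; lia.
Qed.

Lemma perm_del_shiftR j s (v v' : 'I_n.+1) : v' = v.+1 :> nat ->
  s j = v \/ s j = v' -> perm_del j (s * tperm v v') = perm_del j s.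
Proof.
move=> e sj; apply: invg_inj; rewrite !perm_delV invMg tpermV permM.
case: sj => ->; last by rewrite tpermR (perm_del_shift _ e).
by rewrite tpermL -(perm_del_shift _ e) mulgA tperm2 mul1g.
Qed.

Lemma perm_del_fixed_shift j j' s : j' = j.+1 :> nat -> s j = j -> s j' = j' ->
  perm_del j s = perm_del j' s.
Proof.
move=> e sj sj'; rewrite -(perm_del_shift s e).
have -> : tperm j j' * s = s * tperm j j'.
  by rewrite -(mul_permC s) sj sj'.
by rewrite perm_del_shiftR //; left.
Qed.

End PointDeletion.

(** * Sets of permutations closed under $x y^{-1} z$, and their stabilizers *)

Section Torsors.
Variable q : nat.
Local Open Scope group_scope.
Implicit Types (i j k P Q : 'I_q.+2) (s : 'S_q.+2) (d : 'S_q.+1) (x y z : 'I_q.+1).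

(* When positions [i < j] of [a s] carry the same letter, first occurrences forget
   position [j] of [a s] and the larger of the positions [s i], [s j] of [a]. *)
Definition reduction i j s : 'S_q.+1 :=
  perm_del j (if s i < s j then s else tperm i j * s).

Variable C : 'S_q.+1 -> Prop.

(** A nonempty [C] with this closure is a coset of a subgroup; [stabL] and [stabR] describe its left
    and right stabilizers. *)
Definition torsor := forall d1 d2 d3, C d1 -> C d2 -> C d3 -> C (d1 * d2^-1 * d3).

Definition reductions_in s := forall i j, i < j -> C (reduction i j s).

Definition stabL d := forall d', C d' -> C (d * d').
Definition stabR d := forall d', C d' -> C (d' * d).

(** Indices are plain numbers cast by [inord], so that renumbered positions such as [unbump j P] or
    [k.-1] need no bound proofs in the types. *)
Definition swapL (a b : nat) := stabL (tperm (inord a) (inord b)).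
Definition swapR (a b : nat) := stabR (tperm (inord a) (inord b)).

Hypothesis torsorC : torsor.

Lemma stabLM d1 d2 : stabL d1 -> stabL d2 -> stabL (d1 * d2).
Proof. by move=> h1 h2 d Cd; rewrite -mulgA; apply/h1/h2. Qed.

Lemma stabLV d : stabL d -> stabL d^-1.
Proof.
move=> h d' Cd'; have := torsorC Cd' (h _ Cd') Cd'.
by rewrite invMg mulKVg.
Qed.

Lemma stabL_quot d1 d2 : C d1 -> C d2 -> stabL (d1 * d2^-1).
Proof. by move=> h1 h2 d Cd; apply: torsorC. Qed.

Lemma stabL_conj d1 d2 : stabL d1 -> stabL d2 -> stabL (d1 ^ d2).
Proof. by move=> h1 h2; apply: stabLM; [exact: stabLV|exact: stabLM]. Qed.

(** The left and the right stabilizer of a coset are conjugate under each of its members. *)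
Lemma stabLR d d' : C d -> stabL d' <-> stabR (d' ^ d).
Proof.
move=> Cd; split=> h d1 Cd1.
  have := torsorC Cd1 Cd (h _ Cd).
  by rewrite conjgE !mulgA.
have := torsorC (h _ Cd) Cd Cd1.
by rewrite conjgE !mulgA mulgV mul1g mulgK.
Qed.

Lemma swapL_refl a : swapL a a.
Proof. by move=> d; rewrite tperm1 mul1g. Qed.

Lemma swapL_sym a b : swapL a b -> swapL b a.
Proof. by rewrite /swapL tpermC. Qed.

Lemma swapL_trans b a c : swapL a b -> swapL b c -> swapL a c.
Proof.
rewrite /swapL; move: (inord a) (inord b) (inord c) => x y z h1 h2.
have [->|nxz] := eqVneq x z; first by move=> d; rewrite tperm1 mul1g.
have [<-//|nxy] := eqVneq y x.
have [<-//|nyz] := eqVneq y z.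
have := stabL_conj h2 h1; rewrite tpermJ tpermR tpermD //.
Qed.

Lemma swapR_refl a : swapR a a.
Proof. by move=> d; rewrite tperm1 mulg1. Qed.

Lemma swapR_sym a b : swapR a b -> swapR b a.
Proof. by rewrite /swapR tpermC. Qed.

Lemma inord_unbump j P : P != j -> exists2 x, P = lift j x & inord (unbump j P) = x.
Proof.
case: (unliftP j P) => [x ->|->]; last by rewrite eqxx.
by move=> _; exists x => //=; rewrite bumpK inord_val.
Qed.

(* Transport of a transposition along the member [perm_del j s] of [C]; [unbump]
   renumbers the positions and values of [s]. *)
Lemma swapL_swapR j s P Q : C (perm_del j s) -> P != j -> Q != j ->
  swapL (unbump j P) (unbump j Q) <->
  swapR (unbump (s j) (s P)) (unbump (s j) (s Q)).
Proof.
move=> Cs /inord_unbump[x -> ex] /inord_unbump[y -> ey].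
rewrite /swapL /swapR ex ey -!lift_perm_del /= !bumpK !inord_val (stabLR _ Cs).
by rewrite tpermJ.
Qed.

(** The quotient of two members of [C] stabilizes it, and here this quotient is a single
    transposition. *)
Lemma swapL_intro j s P Q : C (perm_del j s) -> C (perm_del j (tperm P Q * s)) ->
  P != j -> Q != j -> swapL (unbump j P) (unbump j Q).
Proof.
move=> Cs Cs' /inord_unbump[x eP ex] /inord_unbump[y eQ ey].
move: Cs'; rewrite eP eQ perm_del_tpermL -eP -eQ /swapL ex ey => Cs'.
by have := stabL_quot Cs' Cs; rewrite mulgK.
Qed.

Lemma swapL_elim j s P Q : C (perm_del j s) -> P != j -> Q != j ->
  swapL (unbump j P) (unbump j Q) -> C (perm_del j (tperm P Q * s)).
Proof.
move=> Cs /inord_unbump[x eP ex] /inord_unbump[y eQ ey].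
by rewrite eP eQ perm_del_tpermL -eP -eQ /swapL ex ey; apply.
Qed.

Lemma swapR_trans b a c : swapR a b -> swapR b c -> swapR a c.
Proof.
rewrite /swapR; move: (inord a) (inord b) (inord c) => x y z h1 h2.
have [->|nxz] := eqVneq x z; first by move=> d; rewrite tperm1 mulg1.
have [<-//|nxy] := eqVneq y x.
have [<-//|nyz] := eqVneq y z.
have <- : tperm y z ^ tperm x y = tperm x z by rewrite tpermJ tpermR tpermD.
by rewrite conjgE tpermV => d Cd; rewrite !mulgA; apply/h1/h2/h1.
Qed.

Lemma swapR_intro j s P Q : C (perm_del j s) -> C (perm_del j (s * tperm P Q)) ->
  P != s j -> Q != s j -> swapR (unbump (s j) P) (unbump (s j) Q).
Proof.
move=> Cs Cs' nP nQ.
have sV (X : 'I_q.+2) : X != s j -> s^-1 X != j.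
  by apply: contraNneq => <-; rewrite permKV.
rewrite -[P](permKV s) -[Q](permKV s) -swapL_swapR ?sV //.
by apply: (swapL_intro Cs); rewrite ?sV // -mul_permC ?permKV.
Qed.

Lemma reductions_inN s i j : reductions_in s -> i < j -> s i < s j -> C (perm_del j s).
Proof. by move=> D lij sij; have := D _ _ lij; rewrite /reduction sij. Qed.

Lemma reductions_inM s i j : reductions_in s -> i < j -> s j < s i -> C (perm_del j (tperm i j * s)).
Proof. by move=> D lij sij; have := D _ _ lij; rewrite /reduction ltnNge (ltnW sij). Qed.

Lemma reductions_in_ind s :
  (forall i j, i < j -> s i < s j -> C (perm_del j s)) ->
  (forall i j, i < j -> s j < s i -> C (perm_del j (tperm i j * s))) -> reductions_in s.
Proof.
move=> hN hM i j lij; rewrite /reduction; case: ltngtP => [sij|sij|/val_inj/perm_inj e].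
- exact: (hN _ _ lij sij).
- exact: (hM _ _ lij sij).
by move: lij; rewrite e ltnn.
Qed.

(* After the exchange, the reductions that involve [k] or [k'] are reductions of
   [s]; the two hypotheses on [swapL] serve the deletions after [k'] and before [k]. *)
Lemma bubble s k k' : k' = k.+1 :> nat -> s k' < s k -> reductions_in s ->
  (k' < q.+1 -> swapL k k') -> (2 <= k -> swapL k.-1 k) -> reductions_in (tperm k k' * s).
Proof.
move=> ek sk D hA hB.
have nkk : k != k' by rewrite -val_eqE /=; lia.
have far j s' : C (perm_del j s') -> 0 < j -> j != k -> j != k' -> C (perm_del j (tperm k k' * s')).
  move=> Cs j0 nk nk'; apply: swapL_elim; rewrite // ?[_ == j]eq_sym //.
  move: nk nk' (ltn_ord j); rewrite -!val_eqE /= /unbump => nk nk' ltj.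
  have [ljk|lkj] := ltnP j k.
    rewrite ek ltnS (ltnW ljk) /= subn1 subn1 /=; apply: hB; lia.
  have -> : (j < k') = false by lia.
  by rewrite !subn0; apply: hA; lia.
apply: reductions_in_ind => i j lij.
  rewrite !permM; have [->|njk] := eqVneq j k'.
    by move=> _; apply: reductions_inM => //; rewrite ek.
  have [ejk|njk'] := eqVneq j k.
    rewrite ejk tpermL perm_del_shift // tpermD // => [sik||].
    - by apply: (reductions_inN D _ sik); rewrite ek -ejk ltnW // ltnS.
    - by rewrite -val_eqE /=; move: lij; rewrite ejk; lia.
    - by rewrite -val_eqE /=; move: lij; rewrite ejk; lia.
  rewrite (tpermD (z := j)) 1?eq_sym // => sij.
  apply: far => //; last by lia.
  apply: (reductions_inN D _ sij); case: tpermP => [ei|ei|//]; subst.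
  - by move: njk lij; rewrite -val_eqE /=; lia.
  - by lia.
rewrite !permM; have [ej|njk] := eqVneq j k'.
  move: lij; rewrite {j}ej => lij; have [->|nik] := eqVneq i k; first by rewrite tpermL tpermR ltnNge (ltnW sk).
  have lik : i < k by move: nik lij; rewrite -val_eqE /= ; lia.
  have nik' : i != k' by rewrite -val_eqE /=; lia.
  rewrite tpermR tpermD 1?eq_sym // => sik.
  have -> : tperm i k' * (tperm k k' * s) = tperm k k' * (tperm i k * s).
    rewrite !mulgA; congr (_ * s); rewrite -(mul_permC (tperm k k')).
    by rewrite tpermR tpermD // eq_sym.
  rewrite -(perm_del_shift _ ek) mulgA tperm2 mul1g; exact: reductions_inM.
have [ejk|njk'] := eqVneq j k.
  have lik : i < k by rewrite -ejk.
  have nik' : i != k' by rewrite -val_eqE /=; lia.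
  have nik : i != k by rewrite -val_eqE /=; lia.
  rewrite ejk tpermL tpermD 1?eq_sym // => sik.
  have -> : tperm i k * (tperm k k' * s) = tperm k k' * (tperm i k' * s).
    rewrite !mulgA; congr (_ * s); rewrite -(mul_permC (tperm k k')).
    by rewrite tpermL tpermD // eq_sym.
  by rewrite (perm_del_shift _ ek); apply: reductions_inM => //; lia.
rewrite (tpermD (z := j)) 1?eq_sym // => sij.
have -> : tperm i j * (tperm k k' * s) = tperm k k' * (tperm (tperm k k' i) j * s).
  rewrite !mulgA; congr (_ * s); rewrite -(mul_permC (tperm k k')).
  by rewrite (tpermD (z := j)) // eq_sym.
apply: far => //; last by lia.
apply: (reductions_inM D _ sij); case: tpermP => [ei|ei|//]; subst.
- by move: njk lij; rewrite -val_eqE /=; lia.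
- by lia.
Qed.

End Torsors.

(** * Duality between positions and values *)

Section Dual.
Variables (q : nat) (C : 'S_q.+1 -> Prop).
Local Open Scope group_scope.

Lemma torsorV : torsor C -> torsor (fun d => C d^-1).
Proof.
move=> tC x y z Cx Cy Cz.
by rewrite !invMg mulgA; apply: tC.
Qed.

(** A reduction replaces two points of the graph by the lower left corner of the rectangle they
    span, which is symmetric under reflection in the diagonal. *)
Lemma reductions_inV s : reductions_in C s -> reductions_in (fun d => C d^-1) s^-1.
Proof.
move=> D; apply: reductions_in_ind => i j lij sij.
  by rewrite perm_delV invgK; apply: reductions_inN sij _ => //; rewrite !permKV.
rewrite perm_delV permM tpermR invMg invgK tpermV.
rewrite -[X in s * tperm X _](permKV s) -[X in s * tperm _ X](permKV s).
rewrite mul_permC tpermC.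
by apply: reductions_inM => //; rewrite !permKV.
Qed.

End Dual.

(** * A weight that measures sortedness *)

Section Weight.
Variable n : nat.
Implicit Types s : 'S_n.

(** Sorting a descent increases this sum and inversion preserves it, so it is a termination measure
    for a sorting that may pass to inverses. *)
Definition weight s := \sum_(i < n) i * s i.

Lemma weight_bound s : weight s <= n * (n * n).
Proof.
apply: (@leq_trans (\sum_(i < n) n * n)); last first.
  by rewrite sum_nat_const card_ord.
by apply: leq_sum => i _; rewrite leq_mul // ltnW.
Qed.

Lemma weightV s : weight s^-1 = weight s.
Proof.
rewrite /weight (reindex_inj (@perm_inj _ s)) /=.
by apply: eq_bigr => i _; rewrite permK mulnC.
Qed.

Lemma weight_descent s (k k' : 'I_n) : k < k' -> s k' < s k ->
  weight s < weight (tperm k k' * s).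
Proof.
move=> lk sk; have nk : k' != k by rewrite -val_eqE /=; lia.
have split2 (F : 'I_n -> nat) : \sum_i F i =
    F k + (F k' + \sum_(i < n | (i != k) && (i != k')) F i).
  by rewrite (bigD1 k) //= (bigD1 k').
rewrite /weight 2!split2 !permM tpermL tpermR.
under [X in _ < _ + (_ + X)]eq_bigr => i /andP[n1 n2].
  rewrite permM tpermD 1?eq_sym //; over.
rewrite !addnA ltn_add2r; nia.
Qed.

End Weight.

Lemma perm_stable (T : finType) (s : {perm T}) (P : pred T) :
  (forall x, P x -> P (s x)) -> forall x, P (s x) = P x.
Proof.
move=> h x.
have e : s @: [set y in P] = [set y in P].
  apply/eqP; rewrite eqEcard card_imset ?leqnn ?andbT; last exact: perm_inj.
  by apply/subsetP=> _ /imsetP[y + ->]; rewrite !inE => Py; apply: h.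
have := mem_imset [set y in P] x (@perm_inj _ s).
by rewrite e !inE.
Qed.

(** * Sorting in a stable initial segment whose maximum is far from its end *)

Section BigBlock.
Variables (q : nat) (C : 'S_q.+1 -> Prop) (s : 'S_q.+2) (t t1 p : 'I_q.+2).
Local Open Scope group_scope.
Implicit Types (x y z i j k : 'I_q.+2).
Hypotheses (tC : torsor C) (D : reductions_in C s).
Hypotheses (stab : forall i : 'I_q.+2, i <= p -> s i <= p) (st : s t = p).
Hypotheses (t1E : t1 = t.+1 :> nat) (ltp : t1 < p).

Let s_inj (x y : 'I_q.+2) : s x = s y :> nat -> x = y :> nat.
Proof. by move=> /val_inj /perm_inj ->. Qed.

Let s_lt x : x <= p -> x <> t :> nat -> s x < p.
Proof.
move=> xp xt; rewrite ltn_neqAle stab // andbT; apply/eqP => e.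
by apply/xt/s_inj; rewrite st.
Qed.

(** The block maximum sits at [t], so [(t, j)] and [(t, j')] are inverted pairs. Merging either
    moves one of the values [s j], [s j'] to [t] and leaves the other at place [j]; the results
    differ by exchanging these values. *)
Let swapR_next j j' : j' = j.+1 :> nat -> t < j -> j' <= p -> swapR C (s j) (s j').
Proof.
move=> e ltj lej.
have sj : s j < p by apply: s_lt; lia.
have sj' : s j' < p by apply: s_lt; lia.
have C1 : C (perm_del j (tperm t j * s)) by apply: reductions_inM => //; rewrite st.
have C2 : C (perm_del j' (tperm t j' * s)).
  by apply: reductions_inM => //; [lia|rewrite st].
have s1j : (tperm t j * s) j = p by rewrite permM tpermR.
have -> : s j = unbump p (s j) :> nat by rewrite /unbump; lia.
have -> : s j' = unbump p (s j') :> nat by rewrite /unbump; lia.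
rewrite -s1j; apply: (swapR_intro tC C1); rewrite ?s1j -?val_eqE /=; try lia.
have -> : tperm t j * s * tperm (s j) (s j') = tperm j j' * (tperm t j' * s).
  rewrite -mulgA mul_permC !mulgA; congr (_ * s).
  rewrite -(mul_permC (tperm j j') t j) tpermL tpermD //.
    by rewrite -val_eqE /=; lia.
  by rewrite -val_eqE /=; lia.
by rewrite (perm_del_shift _ e).
Qed.

Let swapR_tail j : t < j -> j <= p -> swapR C (s j) (s p).
Proof.
move=> ltj; move eN: (p - j) => N; elim: N j eN ltj => [|N IH] j eN ltj lej.
  have -> : j = p by apply: val_inj => /=; lia.
  exact: swapR_refl.
have hj : j.+1 < q.+2 by have := ltn_ord p; lia.
apply: (@swapR_trans _ C (s (Ordinal hj))); first by apply: swapR_next => //=; lia.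
by apply: IH => /=; lia.
Qed.

Let sp_lt : s p < p.
Proof. by apply: s_lt; lia. Qed.

(** Position [p] is merged with the one carrying the next larger value; exchanging consecutive
    values has no effect once one of them is deleted. *)
Let C_top : C (perm_del p s).
Proof.
have hm : (s p).+1 < q.+2 by have := ltn_ord p; lia.
pose i := s^-1 (Ordinal hm).
have si : s i = (s p).+1 :> nat by rewrite permKV.
have lip : i < p.
  have : i <= p by rewrite -(perm_stable (P := fun x => x <= p) stab) si; exact: sp_lt.
  by rewrite leq_eqVlt => /predU1P[e|//]; have := si; rewrite (val_inj e); lia.
have := reductions_inM D lip; rewrite si => /(_ (leqnn _)).
rewrite -(mul_permC s) tpermC perm_del_shiftR //.
by left.
Qed.

Let s_inv_le (y : 'I_q.+2) : y <= p -> s^-1 y <= p.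
Proof.
by move=> yp; rewrite -(perm_stable (P := fun x => x <= p) stab) permKV.
Qed.

(** Merging [p] with [x] or with [y] puts the value [s p] there; as [s x] and [s y] are consecutive,
    the value left at the other position gets the same number after deletion. *)
Let swapL_next x y : s x = (s y).+1 :> nat -> s p < s y -> x < p -> y < p -> swapL C x y.
Proof.
move=> e lpy xp yp.
have C1 : C (perm_del p (tperm x p * s)) by apply: reductions_inM => //; lia.
have C2 : C (perm_del p (tperm y p * s)) by apply: reductions_inM => //; lia.
have nxy : x != y by apply/eqP=> exy; move: e; rewrite exy; lia.
have nxp : x != p by rewrite -val_eqE /=; lia.
have nyp : y != p by rewrite -val_eqE /=; lia.
have := swapL_intro tC C2 _ nxp nyp.
have ex : unbump p x = x by rewrite /unbump; lia.
have ey : unbump p y = y by rewrite /unbump; lia.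
rewrite ex ey; apply.
have -> : tperm x y * (tperm y p * s) = tperm x p * s * tperm (s y) (s x).
  rewrite -mulgA mul_permC !mulgA; congr (_ * s).
  by rewrite -(mul_permC (tperm y x) x p) tpermR tpermD // tpermC.
by rewrite perm_del_shiftR //; right; rewrite permM tpermR.
Qed.

Let swapL_top x : x < p -> s p < s x -> swapL C x t.
Proof.
move eN: (p - s x) => N; elim: N x eN => [|N IH] x eN xp lpx.
  have -> : x = t by apply: (@perm_inj _ s); apply: val_inj; rewrite /= st; have := stab (ltnW xp); lia.
  exact: swapL_refl.
have hz : (s x).+1 < q.+2 by have := ltn_ord p; lia.
pose z := s^-1 (Ordinal hz).
have sz : s z = (s x).+1 :> nat by rewrite permKV.
have zp : z < p.
  have : z <= p by apply: s_inv_le => /=; lia.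
  by rewrite leq_eqVlt => /predU1P[/val_inj e|//]; move: sz; rewrite e; lia.
apply: (@swapL_trans _ _ tC z); first by apply: swapL_sym; apply: swapL_next.
by apply: IH => //; lia.
Qed.

Let nep x : x < p -> x != p.
Proof. by rewrite -val_eqE /=; lia. Qed.

(** This is [swapL_top] transported along [perm_del p s], where values above [s p] are lowered by
    one. *)
Let swapR_top c : s p <= c -> c < p -> swapR C c p.-1.
Proof.
move=> h1 h2; have hz : c.+1 < q.+2 by have := ltn_ord p; lia.
pose z := s^-1 (Ordinal hz).
have sz : s z = c.+1 :> nat by rewrite permKV.
have zp : z < p.
  have : z <= p by apply: s_inv_le => /=; lia.
  by rewrite leq_eqVlt => /predU1P[/val_inj e|//]; move: sz; rewrite e; lia.
have ltt : t < p by lia.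
have := swapL_swapR tC C_top (nep zp) (nep ltt).
have -> : unbump p z = z by rewrite /unbump; lia.
have -> : unbump p t = t by rewrite /unbump; lia.
rewrite st sz; have -> : unbump (s p) c.+1 = c by rewrite /unbump; lia.
have -> : unbump (s p) p = p.-1 by rewrite /unbump; lia.
by move=> <-; apply: swapL_top => //; lia.
Qed.

(** If [s k < s p], the exchange is transported to the values, where it is composed of a link from
    [p.-1] to [s p] and one from [s p] to [s k]. *)
Let swapL_mid k : t < k -> k < p -> swapL C t k.
Proof.
move=> ltk lkp; case: (ltngtP (s p) (s k)) => [h|h|/s_inj]; last by lia.
  by apply: swapL_sym; apply: swapL_top.
have ltt : t < p by lia.
have := swapL_swapR tC C_top (nep ltt) (nep lkp).
have -> : unbump p k = k by rewrite /unbump; lia.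
have -> : unbump p t = t by rewrite /unbump; lia.
rewrite st; have -> : unbump (s p) (s k) = s k by rewrite /unbump; lia.
have -> : unbump (s p) p = p.-1 by rewrite /unbump; lia.
move=> ->; apply: (@swapR_trans _ C (s p)); first by apply: swapR_sym; apply: swapR_top; lia.
by apply: swapR_sym; apply: swapR_tail; lia.
Qed.

(** Merging two positions before [t] renumbers [t] to [t.-1], which makes exchanges with [t.-1]
    accessible. *)
Let C_pair i j : i < t -> j < t -> i <> j -> exists j' s',
  [/\ C (perm_del j' s'), j' < t, s' j' = maxn (s i) (s j) :> nat &
      forall x, t <= x -> s' x = s x].
Proof.
wlog lij : i j / i < j => [hw it jt ij|it jt _].
  case: (ltngtP i j) => [h|h|/val_inj //]; first exact: hw.
  have [//|//|e|j' [s' [h1 h2 h3 h4]]] := hw _ _ h; first by case: ij.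
  by exists j', s'; rewrite maxnC.
case: (ltngtP (s i) (s j)) => [h|h|/s_inj]; last by lia.
  by exists j, s; split=> //; apply: reductions_inN h.
exists j, (tperm i j * s); split=> //; first exact: reductions_inM.
  by rewrite permM tpermR.
by move=> x tx; rewrite permM tpermD // -val_eqE /=; lia.
Qed.

Let swapL_prev : 2 <= t -> swapL C t.-1 t.
Proof.
move=> t2.
have sy : s t1 < p by apply: s_lt; lia.
have sy_p : s t1 <> s p :> nat by move/s_inj; lia.
have h0 : 0 < q.+2 by [].
have h1 : 1 < q.+2 by [].
have ne_of x j' : j' < x -> x != j' by rewrite -val_eqE /=; lia.
(* If some value before [t] is at least [s p - 1], deleting it or a larger one leaves [s t1] with a
   number that is linked to [p.-1]. *)
have [h /andP[lht lph]|small] := pickP (fun h : 'I_q.+2 => (h < t) && (s p <= (s h).+1)).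
  have [h' lh't nhh'] : exists2 h' : 'I_q.+2, h' < t & h <> h'.
    case: (posnP h) => [e|gt]; [exists (Ordinal h1)|exists (Ordinal h0)] => //=; try lia.
      by move=> e1; move: e; rewrite e1.
    by move=> e1; move: gt; rewrite e1.
  have sh : s h < p by apply: s_lt; lia.
  have sh' : s h' < p by apply: s_lt; lia.
  have n1 : s h <> s t1 :> nat by move/s_inj; lia.
  have n2 : s h' <> s t1 :> nat by move/s_inj; lia.
  have n3 : s h <> s p :> nat by move/s_inj; lia.
  have n4 : s h' <> s p :> nat by move/s_inj; lia.
  have [j' [s' [C' lj' vj' s'E]]] := C_pair lht lh't nhh'.
  have nt : t != j' by apply: ne_of.
  have nt1 : t1 != j' by apply: ne_of; lia.
  have := swapL_swapR tC C' nt nt1.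
  have -> : unbump j' t = t.-1 by rewrite /unbump; lia.
  have -> : unbump j' t1 = t by rewrite /unbump; lia.
  move=> ->; rewrite vj' !s'E ?st //; last lia.
  have -> : unbump (maxn (s h) (s h')) p = p.-1 by rewrite /unbump; lia.
  apply: swapR_sym; case: (ltngtP (s t1) (s p)) => // ltm.
    have -> : unbump (maxn (s h) (s h')) (s t1) = s t1 by rewrite /unbump; lia.
    by apply: (@swapR_trans _ C (s p)); [apply: swapR_tail|apply: swapR_top]; lia.
  by apply: swapR_top; rewrite /unbump; lia.
(* Otherwise the value [s p - 1] occurs strictly between [t] and [p], and deleting a smaller value
   turns [s p] into that number. *)
have sm0 := small (Ordinal h0); have sm1 := small (Ordinal h1).
have lt0 : Ordinal h0 < t by rewrite /=; lia.
have n01 : Ordinal h0 <> Ordinal h1 by [].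
have [j' [s' [C' lj' vj' s'E]]] := @C_pair _ (Ordinal h1) lt0 t2 n01.
have hz : (s p).-1 < q.+2 by have := ltn_ord (s p); lia.
pose h := s^-1 (Ordinal hz).
have sh : s h = (s p).-1 :> nat by rewrite permKV.
have hp : h <= p by apply: s_inv_le => /=; lia.
have nht : ~~ (h < t) by apply/negP => lht; have := small h; rewrite lht sh; lia.
have lm : (s (Ordinal h0)).+1 < s p by move: sm0 => /=; lia.
have lm' : (s (Ordinal h1)).+1 < s p by move: sm1 => /=; lia.
have htn : h <> t :> nat by move=> /val_inj e; move: sh; rewrite e st; lia.
have hpn : h <> p :> nat by move=> /val_inj e; move: sh; rewrite e; lia.
have nt : t != j' by apply: ne_of.
have np : p != j' by apply: ne_of; lia.
apply: (@swapL_trans _ _ tC p.-1); last first.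
  have hp1 : p.-1 < q.+2 by have := ltn_ord p; lia.
  by apply: swapL_sym; apply: (swapL_mid (k := Ordinal hp1)) => /=; lia.
have := swapL_swapR tC C' nt np.
have -> : unbump j' t = t.-1 by rewrite /unbump; lia.
have -> : unbump j' p = p.-1 by rewrite /unbump; lia.
move=> ->; rewrite vj' !s'E ?st //; last lia.
have -> : unbump (maxn (s (Ordinal h0)) (s (Ordinal h1))) p = p.-1 by rewrite /unbump; lia.
have -> : unbump (maxn (s (Ordinal h0)) (s (Ordinal h1))) (s p) = s h.
  by rewrite /unbump sh; lia.
apply: swapR_sym; apply: (@swapR_trans _ C (s p)); last by apply: swapR_top; lia.
by apply: swapR_tail; lia.
Qed.

(** The stable transposition is returned as well, since it is needed when the exchange happens to
    produce [tau]. *)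
Lemma big_block_step : [/\ s t1 < s t, reductions_in C (tperm t t1 * s) & swapL C t t1].
Proof.
have lt1 : swapL C t t1 by apply: swapL_mid; lia.
have lts : s t1 < s t by rewrite st s_lt //; lia.
by split=> //; apply: bubble => // _; apply: swapL_prev.
Qed.

End BigBlock.

(* The exchange of [n-1] with [n-2], of [n-3] with [n-4] and so on; [0] is fixed when
   [n] is odd, since then [0.-1 = 0]. *)
Definition tau (n i : nat) := if odd (n - i) then i.-1 else i.+1.

(** * Possible shapes of a permutation *)

Section Shape.
Variable n : nat.
Implicit Types (s : 'S_n) (i j p t : 'I_n).
Local Open Scope group_scope.

Definition is_tau s := [forall i, (s i : nat) == tau n i].

Definition short s := forall i, s i <= i.+1 /\ i <= (s i).+1.

Lemma perm_val_inj s i j : s i = s j :> nat -> i = j :> nat.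
Proof. by move=> /val_inj /perm_inj ->. Qed.

Lemma is_tauE s i : is_tau s -> s i = tau n i :> nat.
Proof. by move/forallP/(_ i)/eqP. Qed.

(** If no point moves by more than one, moved points are exchanged in neighbouring pairs; without
    fixed points other than [0], the pairing is forced from the top down. *)
Lemma short_derangement_tau s :
  short s -> (forall i, s i = i -> i = 0 :> nat) -> is_tau s.
Proof.
move=> hs hfix; apply/forallP=> i; apply/eqP.
move eN: (n - i) => N; elim/ltn_ind: N i eN => N IH i eN.
have lti := ltn_ord i; have [h1 h2] := hs i.
have up (j : 'I_n) : i < j -> s j = tau n j :> nat by move=> lij; apply: (IH (n - j)); lia.
have [od|ev] := boolP (odd (n - i)).
  rewrite /tau od; have ne1 : s i <> i.+1 :> nat.
    have [lt2|] := ltnP i.+2 n; last by have := ltn_ord (s i); lia.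
    have := up (Ordinal lt2); rewrite /tau /= => /(_ (leqW (leqnn _))).
    have -> : odd (n - i.+2) = true by lia.
    by move=> e2 e1; have := @perm_val_inj s i (Ordinal lt2); rewrite e1 e2 /= => /(_ erefl); lia.
  have [/val_inj/hfix|] : s i = i :> nat \/ s i <> i :> nat by lia.
    by move=> e; have := h2; lia.
  by lia.
rewrite /tau (negbTE ev).
have lt1 : i.+1 < n by lia.
have := up (Ordinal lt1) (ltnSn _); rewrite /tau /=.
have -> : odd (n - i.+1) = true by lia.
move=> e1; pose z := s^-1 (Ordinal lt1).
have sz : s z = i.+1 :> nat by rewrite permKV.
have [h3 h4] := hs z; rewrite sz in h3 h4.
have nz1 : z <> i.+1 :> nat.
  move=> e; have ez : z = Ordinal lt1 by apply: val_inj.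
  by move: e1; rewrite -ez sz; lia.
have [e|lt2] : z = i :> nat \/ i.+1 < z by lia.
  by rewrite -sz -(val_inj e).
by have := up z (ltnW lt2); rewrite /tau sz; case: ifP; lia.
Qed.

Definition big_block s (p t : 'I_n) :=
  [/\ forall i, i <= p -> s i <= p, s t = p & t.+1 < p].

(** Points are peeled off from the top. If the preimage or the image of the largest remaining point
    [p] is less than [p - 1], there is a big block for [s] or for its inverse; otherwise one or two
    points are peeled off. *)
Lemma shape_cases s : (exists p t, big_block s p t) \/ (exists p t, big_block s^-1 p t) \/ short s.
Proof.
suff H m : m <= n -> (forall i, i < m -> s i < m) ->
    (forall i, m <= i -> s i <= i.+1 /\ i <= (s i).+1) ->
  (exists p t, big_block s p t) \/ (exists p t, big_block s^-1 p t) \/ short s.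
  by apply: (H n) => // i; have := ltn_ord i; lia.
elim/ltn_ind: m => -[|m] IH lemn stab hm.
  by right; right=> i; apply: hm.
pose p : 'I_n := Ordinal lemn; pose t := s^-1 p.
have st : s t = p by rewrite permKV.
have stabV i : s i < m.+1 -> i < m.+1.
  by rewrite (perm_stable (P := fun x : 'I_n => x < m.+1)).
have tm : t < m.+1 by apply: stabV; rewrite st.
have [lt1|ge1] := ltnP t.+1 m.
  by left; exists p, t; split.
have [lt2|ge2] := ltnP (s p).+1 m.
  right; left; exists p, (s p); split; rewrite ?permK // => i ip.
  by have := stabV (s^-1 i); rewrite permKV; apply.
have spm : s p < m.+1 by apply: stab.
have [etp|ntp] := eqVneq t p.
  apply: (IH m) => // [|i|i]; first by lia.
    move=> im; have := stab i (leqW im); rewrite ltnS leq_eqVlt => /predU1P[e|//].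
    have := @perm_val_inj s i t; rewrite st e => /(_ erefl); rewrite etp /=; lia.
  rewrite leq_eqVlt => /predU1P[e|]; last exact: hm.
  have -> : i = p by exact: val_inj.
  by rewrite -{1 4}etp st /=; lia.
have ntp' : t <> m :> nat by move=> e; case/eqP: ntp; apply: val_inj.
have nsp : s p <> m :> nat by move=> e; apply: ntp'; have := @perm_val_inj s t p; rewrite st e; apply.
apply: (IH m.-1) => [|||].
- by lia.
- by lia.
- move=> i im; have := stab i; have := @perm_val_inj s i t; have := @perm_val_inj s i p; rewrite st /=; lia.
move=> i im; have [/hm //|lim] := leqP m.+1 i.
have [e|e] : i = p :> nat \/ i = t :> nat by rewrite /=; lia.
  by rewrite (val_inj e) /=; lia.
by rewrite (val_inj e) st /=; lia.
Qed.

End Shape.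

(** * Sorting a short permutation with a fixed point *)

Section ShortStep.
Local Open Scope group_scope.

(** Take the moved point nearest to [p] above it or, failing that, below it. Its neighbour towards
    [p] is fixed, so it is exchanged with its other neighbour. *)
Lemma short_adjacent n (s : 'S_n) (p : 'I_n) :
    short s -> s p = p -> 0 < p -> s != 1 ->
  exists k k' f : 'I_n, [/\ k' = k.+1 :> nat, s k = k', s k' = k, s f = f &
    f = k'.+1 :> nat \/ f.+1 = k /\ 0 < f].
Proof.
move=> hs sp p0 s1.
have [i0 mi0] : exists i, s i != i.
  apply/existsP; apply: contraR s1 => /existsPn h; apply/eqP/permP=> i.
  by rewrite perm1; apply/eqP; have := h i; rewrite negbK.
have pre (i : 'I_n) : exists2 z, s z = i & z <= i.+1 /\ i <= z.+1.
  by exists (s^-1 i); rewrite ?permKV //; have := hs (s^-1 i); rewrite permKV; lia.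
have ne_val (i j : 'I_n) : i != j -> i <> j :> nat by move=> h /val_inj/eqP; apply/negP.
have [i1 /andP[lt1 mi1]|nomove] := pickP (fun i : 'I_n => (p < i) && (s i != i)).
  case: (@arg_minnP _ i1 (fun i => (p < i) && (s i != i)) (fun i => i)); first by rewrite lt1.
  move=> i /andP[lpi mi] min_i; have lt_f : i.-1 < n by have := ltn_ord i; lia.
  pose f := Ordinal lt_f.
  have sf : s f = f.
    have [->//|nfp] := eqVneq f p; apply/eqP; apply: contraT => mf.
    have := min_i f; rewrite mf andbT => /(_ _); have := ne_val _ _ nfp.
    by rewrite /=; lia.
  have nif : s i <> i.-1 :> nat.
    by move=> e; have := @perm_val_inj _ s i f; rewrite e sf /= => /(_ erefl); lia.
  have si : s i = i.+1 :> nat by have := hs i; have := ne_val _ _ mi; lia.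
  exists i, (s i), f; split=> //; last by right; rewrite /=; lia.
  have [z sz hz] := pre i; have nzi : z <> i :> nat.
    by move=> /val_inj e; case/eqP: mi; rewrite -{1}e.
  have nzf : z <> f :> nat.
    by move=> /val_inj e; move: sz; rewrite e sf => /(congr1 (@nat_of_ord _)) /=; lia.
  have -> : s i = z by apply: val_inj; rewrite /= si; move: nzf hz; rewrite /=; lia.
  exact: sz.
have lt0 : i0 < p.
  have := nomove i0; rewrite mi0 andbT ltnNge => /negbFE; rewrite leq_eqVlt.
  by case/predU1P=> // /val_inj e; case/eqP: mi0; rewrite e.
case: (@arg_maxnP _ i0 (fun i => (i < p) && (s i != i)) (fun i => i)); first by rewrite lt0.
move=> i /andP[lip mi] max_i; have lt_f : i.+1 < n by have := ltn_ord p; lia.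
pose f := Ordinal lt_f.
have sf : s f = f.
  have [->//|nfp] := eqVneq f p; apply/eqP; apply: contraT => mf.
  have := max_i f; rewrite mf andbT => /(_ _); have := ne_val _ _ nfp.
  by rewrite /=; lia.
have nif : s i <> i.+1 :> nat.
  by move=> e; have := @perm_val_inj _ s i f; rewrite e sf /= => /(_ erefl); lia.
have si : (s i).+1 = i by have := hs i; have := ne_val _ _ mi; lia.
exists (s i), i, f; split=> //; last by left.
have [z sz hz] := pre i; have nzi : z <> i :> nat.
  by move=> /val_inj e; case/eqP: mi; rewrite -{1}e.
have nzf : z <> f :> nat.
  by move=> /val_inj e; move: sz; rewrite e sf => /(congr1 (@nat_of_ord _)) /=; lia.
have -> : s i = z by apply: val_inj; move: nzf hz => /=; lia.
exact: sz.
Qed.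

Variables (q : nat) (C : 'S_q.+1 -> Prop) (s : 'S_q.+2) (k k' f : 'I_q.+2).
Hypotheses (tC : torsor C) (D : reductions_in C s) (hs : short s).
Hypotheses (kk' : k' = k.+1 :> nat) (sk : s k = k') (sk' : s k' = k) (sf : s f = f).

Let o0 : 'I_q.+2 := Ordinal (isT : 0 < q.+2).
Let o1 : 'I_q.+2 := Ordinal (isT : 1 < q.+2).

Let neq (i j : 'I_q.+2) : i <> j :> nat -> i != j.
Proof. by move=> h; apply/eqP => e; apply: h; rewrite e. Qed.

Let u_fix (i : 'I_q.+2) : i = k \/ i = k' -> (tperm k k' * s) i = i.
Proof. by case=> ->; rewrite permM ?tpermL ?tpermR. Qed.

Let C_merge : C (perm_del k' (tperm k k' * s)).
Proof. by apply: reductions_inM; rewrite // ?sk ?sk' kk'. Qed.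

(** After the exchange [k'] and [f] are neighbouring fixed points, so deleting [f] then gives the
    merge of [k] and [k']. Comparison with the deletion of [f] from [s] yields a stable
    transposition. *)
Let step_fixed_after : f = k'.+1 :> nat -> reductions_in C (tperm k k' * s).
Proof.
move=> fE.
have uf : (tperm k k' * s) f = f.
  by rewrite permM tpermD //; apply: neq; lia.
have C1 : C (perm_del f s) by apply: (@reductions_inN _ _ _ k) => //; rewrite ?sk ?sf; lia.
have C2 : C (perm_del f (tperm k k' * s)).
  rewrite -(perm_del_fixed_shift fE) //; apply: u_fix; by right.
have nk : k != f by apply: neq; lia.
have nk' : k' != f by apply: neq; lia.
have uk : unbump f k = k by rewrite /unbump; lia.
have uk' : unbump f k' = k' by rewrite /unbump; lia.
have L : swapL C k k' by have := swapL_intro tC C1 C2 nk nk'; rewrite uk uk'.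
have RR : swapR C k' k.
  by have := swapL_swapR tC C1 nk nk'; rewrite uk uk' sf sk sk' uk uk' => <-.
apply: bubble => // [|k2]; first by rewrite sk sk'; lia.
(* Merging the positions [0] and [1] shifts [k] and [f] down by one and so reaches [k.-1]. *)
have s0 : s o0 <= 1 by have [] := hs o0.
have s1 : s o1 <= 2 by have [] := hs o1.
have s1k : s o1 <> k :> nat.
  by rewrite -sk' => /perm_val_inj; rewrite /=; lia.
have [s' [C' s'1 s'E]] : exists s' : 'S_q.+2,
    [/\ C (perm_del o1 s'), s' o1 < k & forall i : 'I_q.+2, 1 < i -> s' i = s i].
  case: (ltngtP (s o0) (s o1)) => [h|h|/perm_val_inj //].
    exists s; split=> //; last lia.
    by apply: reductions_inN h.
  exists (tperm o0 o1 * s); split=> //; first exact: reductions_inM.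
    by rewrite permM tpermR; lia.
  by move=> i i1; rewrite permM tpermD //; apply: neq => /=; lia.
have nk1 : k != o1 by apply: neq => /=; lia.
have nf1 : f != o1 by apply: neq => /=; lia.
have := swapL_swapR tC C' nk1 nf1; rewrite (s'E k) // (s'E f); last lia.
have -> : unbump o1 k = k.-1 by rewrite /unbump /=; lia.
have -> : unbump o1 f = k' by rewrite /unbump /=; lia.
rewrite sk sf; have -> : unbump (s' o1) k' = k by rewrite /unbump /=; lia.
have -> : unbump (s' o1) f = k' by rewrite /unbump /=; lia.
move=> [_ /(_ (swapR_sym RR))] L'; apply: (swapL_trans tC L'); exact: swapL_sym.
Qed.

Let step_fixed_before : f.+1 = k -> 0 < f -> reductions_in C (tperm k k' * s).
Proof.
move=> fE f0.
have uf : (tperm k k' * s) f = f.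
  by rewrite permM tpermD //; apply: neq; lia.
have s0 : s o0 <= 1 by have [] := hs o0.
have s0f : s o0 < f.
  have : s o0 <> f :> nat by rewrite -sf => /perm_val_inj; rewrite /=; lia.
  lia.
have C1 : C (perm_del f s) by apply: (@reductions_inN _ _ _ o0) => //; rewrite sf.
have C2 : C (perm_del f (tperm k k' * s)).
  rewrite (@perm_del_fixed_shift _ f k) //; last by apply: u_fix; left.
  by rewrite (@perm_del_fixed_shift _ k k') //; apply: u_fix; [left|right].
have nk : k != f by apply: neq; lia.
have nk' : k' != f by apply: neq; lia.
have uk : unbump f k = k.-1 by rewrite /unbump; lia.
have uk' : unbump f k' = k by rewrite /unbump; lia.
have L : swapL C k.-1 k by have := swapL_intro tC C1 C2 nk nk'; rewrite uk uk'.
have RR : swapR C k k.-1.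
  by have := swapL_swapR tC C1 nk nk'; rewrite uk uk' sf sk sk' uk uk' => <-.
apply: bubble => // [|k'q]; first by rewrite sk sk'; lia.
(* Deleting the last position leaves [k'] and [f] in place, which links [k'] with [k.-1]. *)
have sM : q <= s ord_max by have [] := hs ord_max; rewrite /=; lia.
have snk : s ord_max <> k' :> nat by rewrite -sk => /perm_val_inj; rewrite /=; lia.
have C3 : C (perm_del ord_max s).
  by apply: (@reductions_inN _ _ _ o0) => //; lia.
have nk1 : k' != ord_max by apply: neq => /=; lia.
have nf1 : f != ord_max by apply: neq => /=; lia.
have := swapL_swapR tC C3 nk1 nf1; rewrite sk' sf.
have -> : unbump (@ord_max q.+1) k' = k' by rewrite /unbump /=; lia.
have -> : unbump (@ord_max q.+1) f = k.-1 by rewrite /unbump /=; lia.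
have -> : unbump (s ord_max) k = k by rewrite /unbump /=; lia.
have -> : unbump (s ord_max) f = k.-1 by rewrite /unbump /=; lia.
move=> [_ /(_ RR)] L'; apply: swapL_sym; exact: swapL_trans L' L.
Qed.

Lemma short_step : f = k'.+1 :> nat \/ f.+1 = k /\ 0 < f -> reductions_in C (tperm k k' * s).
Proof. by case=> [|[]]; [exact: step_fixed_after|exact: step_fixed_before]. Qed.

End ShortStep.

(** * Every permutation other than [tau] is harmless *)

Section NonTau.
Variable q : nat.
Local Open Scope group_scope.
Implicit Types (s : 'S_q.+2) (C : 'S_q.+1 -> Prop).

Definition good s := forall C, torsor C -> reductions_in C s -> C 1.

Lemma goodV s : good s^-1 -> good s.
Proof.
move=> h C tC D; have := h _ (torsorV tC) (reductions_inV D).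
by rewrite invg1.
Qed.

Let o0 : 'I_q.+2 := Ordinal (isT : 0 < q.+2).
Let o1 : 'I_q.+2 := Ordinal (isT : 1 < q.+2).

Lemma perm_del1 (j : 'I_q.+2) : perm_del j 1 = 1.
Proof. by apply: perm_del_unique => x; rewrite !perm1. Qed.

Lemma good1 : good 1.
Proof.
move=> C _ D; rewrite -(perm_del1 o1).
by apply: (@reductions_inN _ _ _ o0) => //; rewrite !perm1.
Qed.

Let neq (i j : 'I_q.+2) : i <> j :> nat -> i != j.
Proof. by move=> h; apply/eqP => e; apply: h; rewrite e. Qed.

(* Sorting must not stop at [tau]; the transposition that led there allows one more
   exchange, after which [p] is fixed. *)
Lemma tau_after_big_block C s (t t1 p : 'I_q.+2) :
    torsor C -> reductions_in C s -> is_tau s -> swapL C t t1 ->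
    t1 = t.+1 :> nat -> t1 < p -> s t1 = p ->
  [/\ reductions_in C (tperm t1 p * s), s p < s t1 & ~~ is_tau (tperm t1 p * s)].
Proof.
move=> tC D ts L t1E ltp st1; have ltpn := ltn_ord p.
have := is_tauE t1 ts; rewrite {1}st1 /tau; case: ifP => [_|ev pE]; first lia.
have sp : s p = t1 :> nat by rewrite (is_tauE p ts) /tau; case: ifP; lia.
have slt : s p < s t1 by rewrite sp st1.
have svt : s t < t1 by rewrite (is_tauE t ts) /tau; case: ifP; lia.
split=> //; last first.
  by apply/negP => /(is_tauE p); rewrite permM tpermR st1 /tau; case: ifP; lia.
apply: (bubble pE slt D) => [pq|_]; last by rewrite {1}t1E.
have nt : t != p by apply: neq; lia.
have nt1 : t1 != p by apply: neq; lia.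
have C1 : C (perm_del p (tperm t1 p * s)) by apply: reductions_inM.
have RR : swapR C (s t) t1.
  have := swapL_swapR tC C1 nt nt1.
  have -> : unbump p t = t by rewrite /unbump; lia.
  have -> : unbump p t1 = t1 by rewrite /unbump; lia.
  rewrite !permM tpermR tpermL (tpermD (z := t)); try by apply: neq; lia.
  rewrite st1; have -> : unbump p (s t) = s t by rewrite /unbump; lia.
  have -> : unbump p (s p) = t1 by rewrite /unbump; lia.
  by move=> <-.
(* Deleting the last position leaves [t] and [p] in place and turns the exchange of the values [s t]
   and [t1] into that of the positions [t] and [p]. *)
have sM : s ord_max = q :> nat.
  by rewrite (is_tauE _ ts) /tau /= subSnn.
have s0 : s o0 <= 1.
  by rewrite (is_tauE _ ts) /tau; case: ifP => /=; lia.
have q1 : 1 < q by move: ev; lia.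
have C2 : C (perm_del ord_max s).
  by apply: (@reductions_inN _ _ _ o0) => //; rewrite sM; lia.
have nm : t != ord_max by apply: neq => /=; lia.
have pm : p != ord_max by apply: neq => /=; lia.
have := swapL_swapR tC C2 nm pm; rewrite sM sp.
have -> : unbump (@ord_max q.+1) t = t by rewrite /unbump /=; lia.
have -> : unbump (@ord_max q.+1) p = p by rewrite /unbump /=; lia.
have -> : unbump q (s t) = s t by rewrite /unbump; lia.
have -> : unbump q t1 = t1 by rewrite /unbump; lia.
move=> [_ /(_ RR)] L'; apply: (swapL_trans tC _ L'); exact: swapL_sym.
Qed.

(** Each exchange raises the bounded weight. One is available for a big block, in [s] or its
    inverse, and for a short [s] other than [1] with a fixed point besides [0]; a short [s] without
    such a point is [tau]. *)
Theorem non_tau_good s : ~~ is_tau s -> good s.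
Proof.
move eN: (q.+2 * (q.+2 * q.+2) - weight s) => N.
elim/ltn_ind: N s eN => N IH0 s eN nts.
have IH s' : weight s < weight s' -> ~~ is_tau s' -> good s'.
  by move=> lw; apply: (IH0 (q.+2 * (q.+2 * q.+2) - weight s')) => //;
     have := weight_bound s'; lia.
have big s0 p t : weight s0 = weight s -> big_block s0 p t -> good s0.
  move=> ws [stab st ltp] C tC D.
  have lt1 : t.+1 < q.+2 by have := ltn_ord p; lia.
  pose t1 := Ordinal lt1.
  have t1E : t1 = t.+1 :> nat by [].
  have [lts D1 L] := big_block_step tC D stab st t1E ltp.
  have ltt : t < t1 by rewrite t1E.
  have := weight_descent ltt lts; rewrite ws => w1.
  have [ts|nt] := boolP (is_tau (tperm t t1 * s0)); last exact: (IH _ w1 nt C tC D1).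
  have st1 : (tperm t t1 * s0) t1 = p by rewrite permM tpermR.
  have [D2 lt2 nt2] := tau_after_big_block tC D1 ts L t1E ltp st1.
  have ltp1 : t1 < p by [].
  exact: (IH _ (ltn_trans w1 (weight_descent ltp1 lt2)) nt2 C tC D2).
case: (shape_cases s) => [[p [t]]|[[p [t]]|hs]].
- exact: big.
- by move=> b; apply: goodV; apply: big b; rewrite weightV.
have [->|s1] := eqVneq s 1; first exact: good1.
have [p /andP[p0 /eqP sp]|nofix] := pickP (fun p : 'I_q.+2 => (0 < p) && (s p == p)).
  have [k [k' [f [kk' sk sk' sf hf]]]] := short_adjacent hs sp p0 s1.
  move=> C tC D; have D1 := short_step tC D hs kk' sk sk' sf hf.
  have [lk ls] : k < k' /\ s k' < s k by rewrite sk sk' kk'.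
  apply: (IH _ (weight_descent lk ls)) tC D1.
  (* The point [p] is still fixed, whereas [tau] fixes at most [0]. *)
  apply/negP => /(is_tauE p); rewrite permM tpermD.
  - by rewrite sp /tau; case: ifP; lia.
  - by apply/eqP => e; move: sp sk; rewrite -e => -> /(congr1 (@nat_of_ord _)); lia.
  - by apply/eqP => e; move: sp sk'; rewrite -e => -> /(congr1 (@nat_of_ord _)); lia.
case/negP: nts; apply: short_derangement_tau => // i si.
by have := nofix i; rewrite si eqxx andbT lt0n => /negbFE/eqP.
Qed.

End NonTau.

(** * The permutation [tau] and its sign *)

Lemma tau_lt n i : i < n -> tau n i < n.
Proof. by rewrite /tau; case: ifP; lia. Qed.

Lemma tauK n i : i < n -> tau n (tau n i) = i.
Proof. by rewrite {2}/tau; case: ifP => e lt; rewrite /tau; case: ifP; lia. Qed.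

Section TauPerm.
Variable n : nat.

Definition tau_fun (i : 'I_n) : 'I_n := Ordinal (tau_lt (ltn_ord i)).

Lemma tau_funK : involutive tau_fun.
Proof. by move=> i; apply: val_inj; rewrite /= tauK. Qed.

Definition tau_perm : 'S_n := perm (inv_inj tau_funK).

Lemma is_tau_perm : is_tau tau_perm.
Proof. by apply/forallP => i; rewrite permE. Qed.

Lemma is_tau_unique (s s' : 'S_n) : is_tau s -> is_tau s' -> s = s'.
Proof. by move=> h h'; apply/permP=> i; apply: val_inj; rewrite /= (is_tauE i h) (is_tauE i h'). Qed.

End TauPerm.

Lemma val_perm_del n (j : 'I_n.+1) (s : 'S_n.+1) (x : 'I_n) :
  perm_del j s x = unbump (s j) (s (lift j x)) :> nat.
Proof. by rewrite -lift_perm_del /= bumpK. Qed.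

Section LastBlock.
Variable n : nat.
Local Open Scope group_scope.
Variable s : 'S_n.+2.
Hypothesis ts : is_tau s.

Let a : 'I_n.+2 := lift ord_max (ord_max : 'I_n.+1).
Let b : 'I_n.+2 := ord_max.

Let aE : a = n :> nat.
Proof. by rewrite /= /bump; lia. Qed.

Let sa : s a = b.
Proof. by apply: val_inj; rewrite /= (is_tauE _ ts) /tau aE; case: ifP; lia. Qed.

Let sb : s b = a.
Proof. by apply: val_inj; rewrite /= (is_tauE _ ts) /tau /=; rewrite /bump; case: ifP; lia. Qed.

Lemma last_merge C : reductions_in C s -> C (perm_del b (tperm a b * s)).
Proof. by move=> D; apply: reductions_inM => //; rewrite ?sa ?sb aE. Qed.

(** The deleted point lies on the diagonal, so only the transposition affects the sign. *)
Lemma odd_last_merge : odd_perm (perm_del b (tperm a b * s)) = ~~ odd_perm s.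
Proof.
rewrite odd_perm_del permM tpermR sa addbb addFb odd_permM odd_tperm.
by have -> : a != b by rewrite -val_eqE /= /bump; lia.
Qed.

Lemma last_merge_lt (x : 'I_n.+1) : x < n -> perm_del b (tperm a b * s) x = tau n x :> nat.
Proof.
move=> xn; rewrite val_perm_del permM tpermR sa permM tpermD; first last.
- by rewrite -val_eqE /= /bump; lia.
- by rewrite -val_eqE /= /bump; lia.
rewrite (is_tauE _ ts) /= /bump /unbump /tau.
have -> : (n.+1 <= x) = false by lia.
by rewrite add0n; do 2!case: ifP; lia.
Qed.

Lemma last_merge_max : perm_del b (tperm a b * s) ord_max = ord_max.
Proof.
apply: val_inj; rewrite /= val_perm_del permM tpermR sa permM tpermL sb aE /unbump /=; lia.
Qed.

End LastBlock.

(** The last exchanged pair is removed: its merge flips the sign, and the fixed point left over is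
    deleted without effect on it. *)
Lemma odd_tau n (s : 'S_n) : is_tau s -> odd_perm s = odd n./2.
Proof.
elim/ltn_ind: n s => -[|[|n]] IH s ts.
- by have -> : s = 1%g; [apply/permP; case|rewrite odd_perm1].
- by have -> : s = 1%g; [apply/permP=> i; rewrite !ord1|rewrite odd_perm1].
have o1 := odd_last_merge ts; move: o1.
set d := perm_del _ _ => o1.
have o2 : odd_perm (perm_del ord_max d) = odd_perm d.
  by rewrite odd_perm_del last_merge_max // addbb.
have := IH n (leqW (ltnSn _)) (perm_del ord_max d); rewrite o2 o1 => e.
rewrite /= -e ?negbK //.
apply/forallP => x; apply/eqP; rewrite val_perm_del last_merge_max // last_merge_lt //; last first.
  by rewrite /= /bump; have := ltn_ord x; lia.
have := ltn_ord x; rewrite /= /bump /unbump /tau.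
have -> : (n <= x) = false by have := ltn_ord x; lia.
by rewrite add0n; case: ifP; lia.
Qed.

Lemma perm_increasing n (s : 'S_n) :
  (forall i j : 'I_n, j = i.+1 :> nat -> s i < s j) -> s = 1%g.
Proof.
move=> inc.
have incm m (i j : 'I_n) : j = i + m :> nat -> s i + m <= s j.
  elim: m j => [|m IH] j e; first by rewrite addn0 (val_inj (etrans e (addn0 i) : val j = val i)).
  have lt : i + m < n by have := ltn_ord j; lia.
  by have := IH (Ordinal lt) erefl; have := inc (Ordinal lt) j; rewrite /=; lia.
apply/permP=> i; rewrite perm1; apply: val_inj => /=.
have lti := ltn_ord i; have n0 : 0 < n by lia.
have n1 : n.-1 < n by lia.
have := incm i (Ordinal n0) i erefl.
have := incm (n.-1 - i) i (Ordinal n1); have := ltn_ord (s (Ordinal n1)).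
by rewrite /=; lia.
Qed.

(** * Three-cycles *)

Section ThreeCycles.
Local Open Scope group_scope.

Definition cyc3 (T : finType) (a b c : T) : {perm T} := tperm a b * tperm a c.

Lemma cyc3V (T : finType) (a b c : T) : (cyc3 a b c)^-1 = cyc3 a c b.
Proof. by rewrite invMg !tpermV. Qed.

Lemma cyc3J (T : finType) (a b c : T) (g : {perm T}) :
  cyc3 a b c ^ g = cyc3 (g a) (g b) (g c).
Proof. by rewrite conjMg !tpermJ. Qed.

Lemma cyc3_rot (T : finType) (a b c : T) : uniq [:: a; b; c] -> cyc3 a b c = cyc3 b c a.
Proof.
rewrite /= !inE negb_or andbT => /andP[/andP[nab nac] nbc].
by rewrite /cyc3 -(mul_permC (tperm b a)) tpermL tpermD // (tpermC b a).
Qed.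

Lemma cyc3L (T : finType) (a b c : T) : uniq [:: a; b; c] -> cyc3 a b c a = b.
Proof.
rewrite /= !inE negb_or andbT => /andP[/andP[nab nac] nbc].
by rewrite permM tpermL tpermD // eq_sym.
Qed.

Lemma cyc3M (T : finType) (a b c : T) : cyc3 a b c b = c.
Proof. by rewrite permM tpermR tpermL. Qed.

Lemma cyc3R (T : finType) (a b c : T) : uniq [:: a; b; c] -> cyc3 a b c c = a.
Proof.
rewrite /= !inE negb_or andbT => /andP[/andP[nab nac] nbc].
by rewrite permM (tpermD nac nbc) tpermR.
Qed.

Lemma cyc3_fix (T : finType) (a b c x : T) : x \notin [:: a; b; c] -> cyc3 a b c x = x.
Proof.
rewrite !inE !negb_or => /and3P[na nb nc].
by rewrite permM !tpermD // eq_sym.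
Qed.

End ThreeCycles.

(** * An odd [tau] is harmless *)

Section TauGood.
Variables (q : nat) (C : 'S_q.+1 -> Prop).
Local Open Scope group_scope.
Hypothesis tC : torsor C.

Definition step (x : nat) : 'S_q.+1 := tperm (inord x) (inord x.+1).

Lemma stepK x : step x * step x = 1.
Proof. exact: tperm2. Qed.

Lemma stabL_step_trans x d1 d2 :
  stabL C (d1 * step x) -> stabL C (step x * d2) -> stabL C (d1 * d2).
Proof.
by move=> h1 h2; have := stabLM h1 h2; rewrite -mulgA (mulgA (step x)) stepK mul1g.
Qed.

Section EvenPerms.
Variable x0 : nat.
Hypothesis step2 : forall y, x0 <= y -> y.+1 < q -> stabL C (step y * step y.+1).

Let step_pair y z : x0 <= y -> y < q -> x0 <= z -> z < q -> stabL C (step y * step z).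
Proof.
have base m : x0 + m < q -> stabL C (step x0 * step (x0 + m)).
  elim: m => [|m IH] lt; first by rewrite addn0 stepK => d; rewrite mul1g.
  rewrite addnS.
  apply: (stabL_step_trans (x := x0 + m)); first by apply: IH; lia.
  by apply: step2; lia.
move=> h1 h2 h3 h4.
apply: (stabL_step_trans (x := x0)); last first.
  by rewrite -(subnKC h3); apply: base; lia.
have := stabLV tC (base (y - x0) _); rewrite subnKC // invMg !tpermV; apply; lia.
Qed.

(** Bubble sort with neighbour transpositions taken in pairs; an odd intermediate permutation is
    completed by [step x0]. *)
Lemma stabL_even (d : 'S_q.+1) :
  (forall i : 'I_q.+1, i < x0 -> d i = i) -> ~~ odd_perm d -> stabL C d.
Proof.
suff H : (forall i : 'I_q.+1, i < x0 -> d i = i) ->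
    stabL C (if odd_perm d then step x0 * d else d).
  by move=> hd nd; have := H hd; rewrite (negbTE nd).
move eN: (q.+1 * (q.+1 * q.+1) - weight d) => N.
elim/ltn_ind: N d eN => N IH d eN hd.
have [[i j] /andP[/= /eqP e lt]|none] :=
    pickP (fun z : 'I_q.+1 * 'I_q.+1 => (z.2 == z.1.+1 :> nat) && (d z.2 < d z.1)).
  have x0i : x0 <= i.
    rewrite leqNgt; apply/negP => ix0; move: lt; rewrite (hd i ix0) => lt.
    have : d (d j) = d j by apply: hd; lia.
    by move/perm_inj => dj; move: lt; rewrite dj; lia.
  have nij : i != j by rewrite -val_eqE /=; lia.
  have ltj := ltn_ord j.
  have stE : step i = tperm i j.
    by rewrite /step -e !inord_val.
  have lij : i < j by lia.
  have hd' (x : 'I_q.+1) : x < x0 -> (tperm i j * d) x = x.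
    by move=> xx0; rewrite permM tpermD ?hd // -val_eqE /=; lia.
  have w1 := weight_descent lij lt; have w2 := weight_bound (tperm i j * d).
  have {IH} : stabL C (if odd_perm (tperm i j * d) then step x0 * (tperm i j * d) else tperm i j * d).
    by apply: IH hd'; [|exact: erefl]; lia.
  rewrite odd_permM odd_tperm nij -stE; case: (odd_perm d) => /= L.
    apply: (@stabL_step_trans i); last exact: L.
    by apply: step_pair; lia.
  rewrite -[d]mul1g -(stepK i) -mulgA; apply: (@stabL_step_trans x0).
    by apply: step_pair; lia.
  exact: L.
have -> : d = 1.
  apply: perm_increasing => i j e; have := none (i, j); rewrite /= e eqxx /=.
  move/negbT; rewrite -leqNgt leq_eqVlt => /predU1P[/perm_val_inj|//]; lia.
by rewrite odd_perm1 => d' Cd'; rewrite mul1g.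
Qed.

End EvenPerms.

Variable s : 'S_q.+2.
Hypotheses (ts : is_tau s) (D : reductions_in C s).

Let C_block (X X1 : 'I_q.+2) : X1 = X.+1 :> nat -> ~~ odd (q - X) -> X <= q ->
  [/\ C (perm_del X s), s X = X1 & s X1 = X].
Proof.
move=> e ev le; have sX : s X = X1.
  by apply: val_inj; rewrite /= (is_tauE X ts) /tau; case: ifP; lia.
have sX1 : s X1 = X.
  by apply: val_inj; rewrite /= (is_tauE X1 ts) /tau; case: ifP; lia.
split=> //; have : C (perm_del X1 (tperm X X1 * s)) by apply: reductions_inM; rewrite // ?sX ?sX1 e.
by rewrite -(perm_del_shift _ e) mulgA tperm2 mul1g.
Qed.

Let o (x : nat) : 'I_q.+1 := inord x.

(** The merges of the neighbouring pairs [x, x+1] and [x+2, x+3] differ by this three-cycle. *)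
Let block_cycle x : ~~ odd (q - x) -> x.+2 <= q -> stabL C (cyc3 (o x) (o x.+2) (o x.+1)).
Proof.
move=> ev le; pose X i : 'I_q.+2 := inord (x + i).
have XE i : i <= 3 -> X i = x + i :> nat by move=> h; rewrite inordK //; lia.
have oE i : i <= 2 -> o (x + i) = x + i :> nat by move=> h; rewrite inordK //; lia.
have [|||C0 s0 s1] := @C_block (X 0%N) (X 1%N); rewrite ?XE //; try lia.
have [|||C2 s2 s3] := @C_block (X 2) (X 3); rewrite ?XE //; try lia.
have e : perm_del (X 2) s = cyc3 (o x) (o x.+2) (o x.+1) * perm_del (X 0%N) s.
  apply/permP=> y; apply: val_inj; rewrite /= permM !val_perm_del s0 s2 !(is_tauE _ ts) /=.
  have oE0 := oE 0%N isT; rewrite addn0 in oE0.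
  have oE1 := oE 1%N isT; rewrite addn1 in oE1.
  have oE2 := oE 2%N isT; rewrite addn2 in oE2.
  have X0 := XE 0%N isT; have X1 := XE 1%N isT; have X2 := XE 2%N isT; have X3 := XE 3%N isT.
  have u : uniq [:: o x; o x.+2; o x.+1].
    by rewrite /= !inE negb_or -!val_eqE /= oE0 oE1 oE2; lia.
  rewrite /bump /unbump /tau X0 X1 X2 X3.
  have [yx|y0] := eqVneq y (o x).
    by rewrite yx cyc3L // oE0 oE2; do 2!case: ifP; lia.
  have [yx|y2] := eqVneq y (o x.+2).
    by rewrite yx cyc3M // oE1 oE2; do 2!case: ifP; lia.
  have [yx|y1] := eqVneq y (o x.+1).
    by rewrite yx cyc3R // oE0 oE1; do 2!case: ifP; lia.
  rewrite cyc3_fix ?inE ?negb_or ?y0 ?y1 ?y2 //.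
  move: y0 y1 y2; rewrite -!val_eqE /= oE0 oE1 oE2 => *.
  by do 2!case: ifP; lia.
by have := stabL_quot tC C2 C0; rewrite e mulgK.
Qed.

Let o_uniq x m : x + m <= q -> uniq [seq o i | i <- iota x m.+1].
Proof.
move=> le; rewrite map_inj_in_uniq ?iota_uniq // => i j.
rewrite !mem_iota => hi hj /(congr1 (@nat_of_ord _)).
by rewrite !inordK //; lia.
Qed.

(** A cycle that starts inside a pair comes from conjugating the cycles at [y - 1] and [y + 1] by
    each other. The bound [odd q] leaves out [0] when [tau] fixes it. *)
Let cycle_next y : odd q <= y -> y.+2 <= q -> stabL C (cyc3 (o y) (o y.+2) (o y.+1)).
Proof.
move=> y0 le; have [od|] := boolP (odd (q - y)); last by move=> ev; apply: block_cycle.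
case: y => [|x] in y0 le od *; first by move: od y0; lia.
have le4 : x + 4 <= q by lia.
have := o_uniq le4; rewrite /=.
have A : stabL C (cyc3 (o x) (o x.+1) (o x.+2)).
  by rewrite -cyc3V; apply: (stabLV tC); apply: block_cycle; lia.
have B : stabL C (cyc3 (o x.+2) (o x.+3) (o x.+4)).
  by rewrite -cyc3V; apply: (stabLV tC); apply: block_cycle; lia.
move: (o x) (o x.+1) (o x.+2) (o x.+3) (o x.+4) A B => a b c d e A B u.
have [u1 u2 na nb nd] : [/\ uniq [:: c; d; e], uniq [:: a; b; c],
    a \notin [:: c; d; e], b \notin [:: c; d; e] & d \notin [:: a; b; c]].
  move: u; rewrite /= !inE !negb_or -!andbA andbT; do 9! case/andP => ?; move=> ?.
  by split; repeat (apply/andP; split); rewrite // eq_sym.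
have A' := stabL_conj tC A B; rewrite cyc3J cyc3L // !cyc3_fix // in A'.
have B' := stabL_conj tC A' A; rewrite cyc3J cyc3L // cyc3M cyc3_fix // in B'.
by rewrite -cyc3V; apply: (stabLV tC).
Qed.

Theorem tau_good : odd_perm s -> C 1.
Proof.
move=> os; have Cd := last_merge ts D.
set d := perm_del _ _ in Cd.
(* The merge [d] of the last pair is even, so it lies in the stabilizer as well as in [C]. *)
suff L : stabL C d by have := stabLV tC L Cd; rewrite mulVg.
apply: (@stabL_even (odd q)) => [y y0 yq|i i0|]; last first.
- by rewrite odd_last_merge // negbK.
- apply: val_inj; rewrite /= last_merge_lt //; last by move: i0; lia.
  by rewrite /tau; case: ifP; move: i0; lia.
have /= := o_uniq (_ : y + 2 <= q); rewrite addn2 => /(_ yq) u.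
have := cycle_next y0 yq; rewrite cyc3_rot; last first.
  by move: u; rewrite /= !inE !negb_or !andbT (eq_sym (o y.+2)) => /andP[/andP[-> ->] ->].
rewrite cyc3_rot; last first.
  by move: u; rewrite /= !inE !negb_or !andbT ![_ == o y]eq_sym (eq_sym (o y.+2)) => /andP[/andP[-> ->] ->].
by rewrite /cyc3 (tpermC (o y.+1)).
Qed.

End TauGood.

(** * First occurrences and repeated letters *)

Section FirstOccurrence.
Variable A : eqType.
Implicit Types (s t : seq A) (x : A).

Lemma ofo_uniq s : uniq s -> ofo_seq s = s.
Proof. by move=> us; rewrite /ofo_seq undup_id ?rev_uniq ?revK. Qed.

Lemma ofo_cat_dup s t x : x \in s -> ofo_seq (s ++ x :: t) = ofo_seq (s ++ t).
Proof.
move=> xs; elim/last_ind: t => [|t y IH].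
  by rewrite cats0 cats1 ofo_seq_rcons xs.
rewrite -rcons_cons -!rcons_cat !ofo_seq_rcons IH !mem_cat in_cons.
by have [->|] := eqVneq y x; rewrite ?xs.
Qed.

Lemma ofo_eq_uniq n (a c : n.-tuple A) : uniq c -> (ofo_seq a == c) = (a == c).
Proof.
move=> uc; apply/eqP/eqP => [e|->]; last exact: ofo_uniq.
apply: val_inj; rewrite /= -e ofo_uniq // -rev_uniq; apply: contraT.
by rewrite -ltn_size_undup -size_rev -/(ofo_seq a) e size_rev !size_tuple ltnn.
Qed.

Definition del n (j : 'I_n.+1) (a : n.+1.-tuple A) : n.-tuple A :=
  [tuple tnth a (lift j i) | i < n].

Lemma ofo_del n (i j : 'I_n.+1) (a : n.+1.-tuple A) :
  i < j -> tnth a i = tnth a j -> ofo_seq (del j a) = ofo_seq a.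
Proof.
move=> lij e; pose x0 := tnth a i.
have ltj : j < size a by rewrite size_tuple.
have ea : val a = take j a ++ tnth a j :: drop j.+1 a.
  by rewrite (tnth_nth x0) -drop_nth // cat_take_drop.
have ed : val (del j a) = take j a ++ drop j.+1 a.
  apply: (@eq_from_nth _ x0).
    by rewrite size_cat size_takel ?size_drop ?size_tuple; have := ltn_ord j; lia.
  move=> k; rewrite size_tuple => ltk.
  rewrite -(tnth_nth _ _ (Ordinal ltk)) tnth_mktuple (tnth_nth x0) nth_cat.
  rewrite size_takel ?(ltnW ltj) //= /bump; case: ltnP => h.
    by rewrite nth_take.
  by rewrite nth_drop; congr nth; lia.
rewrite ed [RHS](congr1 (@ofo_seq A) ea) ofo_cat_dup // -e (tnth_nth x0) -(nth_take _ lij).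
by rewrite mem_nth // size_takel // ltnW.
Qed.

End FirstOccurrence.

(** * Reductions realized by repeating a letter *)

Section Reduction.
Variables (A : eqType) (n : nat) (s : 'S_n.+2) (i j : 'I_n.+2).
Hypothesis lij : i < j.

(** The permutation from which [reduction] deletes the point at [j]; it acts like [s] on words with
    equal letters at [s i] and [s j]. *)
Let psi : 'S_n.+2 := (if s i < s j then s else tperm i j * s)%g.

Let psi_lt : psi i < psi j.
Proof.
rewrite /psi; case: (ltngtP (s i) (s j)) => // [h|/perm_val_inj]; last lia.
by rewrite !permM tpermL tpermR.
Qed.

Let psiE (T : Type) (h : 'I_n.+2 -> T) (x : 'I_n.+2) : h (s i) = h (s j) -> h (psi x) = h (s x).
Proof.
by rewrite /psi => e; case: ifP => // _; rewrite permM; case: tpermP => [->|->|].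
Qed.

Lemma ofo_reduction (a : n.+2.-tuple A) : tnth a (s i) = tnth a (s j) ->
  exists b : n.+1.-tuple A, ofo_seq b = ofo_seq a /\
    ofo_seq (tuple_act b (reduction i j s)) = ofo_seq (tuple_act a s).
Proof.
move=> e; exists (del (psi j) a); split.
  by apply: (@ofo_del _ _ (psi i)) => //; rewrite !(psiE (h := tnth a)).
have -> : tuple_act (del (psi j) a) (reduction i j s) = del j (tuple_act a s).
  apply: eq_from_tnth => x; rewrite !tnth_mktuple /reduction -/psi lift_perm_del.
  by rewrite (psiE (h := tnth a)).
by apply: (@ofo_del _ _ i) => //; rewrite !tnth_mktuple.
Qed.

Lemma reduction_lift (b : n.+1.-tuple A) : exists a : n.+2.-tuple A,
  ofo_seq a = ofo_seq b /\
  ofo_seq (tuple_act a s) = ofo_seq (tuple_act b (reduction i j s)).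
Proof.
have nij : psi j != psi i by rewrite -val_eqE /=; lia.
have [y0 ey0] : exists y, psi i = lift (psi j) y by case: (unlift_some nij) => y ->; exists y.
(* The position [psi j] added to [b] repeats the letter at [psi i], whose number in [b] is [y0]. *)
have [a aE] : exists a : n.+2.-tuple A,
    forall x, tnth a x = tnth b (odflt y0 (unlift (psi j) x)).
  exists [tuple tnth b (odflt y0 (unlift (psi j) x)) | x < n.+2] => x.
  by rewrite tnth_mktuple.
have aL y : tnth a (lift (psi j) y) = tnth b y by rewrite aE liftK.
have aj : tnth a (psi j) = tnth a (psi i).
  by rewrite aE unlift_none ey0 aL.
have e : tnth a (s i) = tnth a (s j).
  by move: aj; rewrite /psi; case: ifP => _; rewrite ?permM ?tpermL ?tpermR.
exists a; split.
  have -> : b = del (psi j) a by apply: eq_from_tnth => y; rewrite tnth_mktuple aL.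
  by rewrite (@ofo_del _ _ (psi i)).
have -> : tuple_act b (reduction i j s) = del j (tuple_act a s).
  apply: eq_from_tnth => x; rewrite !tnth_mktuple -(psiE (h := tnth a)) // -lift_perm_del.
  by rewrite aL.
by rewrite (@ofo_del _ _ i) // !tnth_mktuple.
Qed.

End Reduction.

Lemma tuple_actM A n (a : n.-tuple A) (s t : 'S_n) :
  tuple_act (tuple_act a s) t = tuple_act a (t * s)%g.
Proof. by apply: eq_from_tnth => x; rewrite !tnth_mktuple permM. Qed.

Lemma tuple_act1 A n (a : n.-tuple A) : tuple_act a 1%g = a.
Proof. by apply: eq_from_tnth => x; rewrite !tnth_mktuple perm1. Qed.

(** * Permutations compatible with two functions of first occurrences *)

Section Compat.
Variables (A : eqType) (B : Type) (f g : seq A -> B).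

(** As [f] and [g] live on sequences of all lengths, there is one such set of permutations for every
    [n], and reductions lead from one to the next. *)
Definition compat n (s : 'S_n) :=
  forall a : n.-tuple A, f (ofo_seq a) = g (ofo_seq (tuple_act a s)).

Lemma compat_torsor q : torsor (@compat q.+1).
Proof.
move=> x y z cx cy cz a; rewrite -mulgA.
by rewrite cz -!tuple_actM -cx cy tuple_actM mulgV tuple_act1.
Qed.

Lemma compat_reduction q (s : 'S_q.+2) : compat s -> reductions_in (@compat q.+1) s.
Proof.
by move=> cs i j lij b; have [a [<- <-]] := reduction_lift s lij b.
Qed.

End Compat.

Section CompatId.
Variables (A : eqType) (B : Type) (f g : seq A -> B).

Lemma compat_id_next q (s : 'S_q.+2) :
  compat f g s -> ~~ is_tau s || odd (q.+2)./2 -> compat f g (1%g : 'S_q.+1).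
Proof.
move=> cs; have D := compat_reduction cs; have tC := @compat_torsor A B f g q.
have [ts /= od|nts _] := boolP (is_tau s); last exact: (non_tau_good nts tC D).
by apply: (tau_good tC ts D); rewrite odd_tau.
Qed.

Lemma compat_id_next2 q (s : 'S_q.+3) : compat f g s -> compat f g (1%g : 'S_q.+1).
Proof.
move=> cs; have D := compat_reduction cs.
have [od|ev] := boolP (odd (q.+2)./2).
  have l01 : (ord0 : 'I_q.+3) < (ord_max : 'I_q.+3) by [].
  by apply: (compat_id_next (D _ _ l01)); rewrite od orbT.
have [[i j] /andP[/= lij nt]|alltau] :=
    pickP (fun z : 'I_q.+3 * 'I_q.+3 => (z.1 < z.2) && ~~ is_tau (reduction z.1 z.2 s)).
  by apply: (compat_id_next (D _ _ lij)); rewrite nt.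
(* Now every reduction of [s] is the even [tau]. Its singleton is a torsor without [1], so [s] is an
   even [tau] itself, although merging its last pair flips the sign. *)
pose C (d : 'S_q.+2) := d = tau_perm q.+2.
have tC : torsor C by move=> x y z -> -> ->; rewrite /C mulgV mul1g.
have DC : reductions_in C s.
  move=> i j lij; apply: is_tau_unique (is_tau_perm _).
  by have := alltau (i, j); rewrite /= lij => /negbFE.
have no1 : ~ C 1%g.
  move=> e; have := is_tauE ord_max (is_tau_perm q.+2); rewrite -e perm1 /tau /=.
  by rewrite subSnn /=; lia.
exfalso; have [ts|nts] := boolP (is_tau s); last exact/no1/(non_tau_good nts tC DC).
have [od|ev3] := boolP (odd (q.+3)./2).
  by apply/no1/(tau_good tC ts DC); rewrite odd_tau.
have := odd_last_merge ts; rewrite odd_tau ?odd_tau //; last first.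
  by rewrite (last_merge ts DC) is_tau_perm.
by rewrite (negbTE ev) (negbTE ev3).
Qed.

Lemma compat_id q n (s : 'S_n) : q.+3 <= n -> compat f g s -> compat f g (1%g : 'S_q.+1).
Proof.
elim: n s => // n IH s; rewrite leq_eqVlt => /predU1P[[e]|lt] cs.
  by subst n; apply: compat_id_next2 cs.
case: n => [|[|n]] // in IH s lt cs *.
have l01 : (ord0 : 'I_n.+3) < (ord_max : 'I_n.+3) by [].
exact: IH lt (compat_reduction cs l01).
Qed.

End CompatId.

(** * Enough variables: equalizing couples *)

Lemma determined_by_ofoP (A : eqType) (B : Type) (b0 : B) n (f : n.-tuple A -> B) :
  0 < n -> determined_by_ofo f ->
  exists F : seq A -> B, forall a, f a = F (ofo_seq a).
Proof.
move=> n0 [fstar fE].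
(* The default [b0] is taken only outside [Asharp], where [ofo_seq a] never lies. *)
exists (fun w => if insub w is Some w' then fstar w' else b0) => a.
have a0 : 0 < size a by rewrite size_tuple.
by rewrite (fE a a0) (insubT (fun w : seq A => (0 < size w) && uniq w) (ofo_seq_sharp a0)).
Qed.

Lemma determined_by_ofo_seq (A : eqType) (B : Type) n (F : seq A -> B) :
  determined_by_ofo (fun a : n.-tuple A => F (ofo_seq a)).
Proof. by exists (fun w => F (sval w)). Qed.

Lemma equalizing_large (B : Type) (b0 : B) n k : 2 <= n -> k < n ->
  (n = k.+1 -> odd (k.+1)./2) -> equalizing B n k.
Proof.
move=> n2 ltkn hodd A f g cA df dg [s fg] a.
have n0 : 0 < n by exact: ltnW.
have [F fE] := determined_by_ofoP b0 n0 df; have [G gE] := determined_by_ofoP b0 n0 dg.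
have cs : compat F G s by move=> b; rewrite -fE -gE.
have a0 : 0 < size a by rewrite size_tuple.
have /andP[w0 uw] := ofo_seq_sharp a0; rewrite fE gE.
set w := ofo_seq a in w0 uw *.
have wk : size w <= k by rewrite -cA -(card_uniqP uw) max_card.
case ew: (size w) => [|q] in w0 wk *; first by [].
have c1 : compat F G (1%g : 'S_q.+1).
  have [lt|ge] := ltnP q.+2 n; first exact: compat_id cs.
  (* From [q.+1 <= k < n <= q.+2] both values are forced, and the parity condition applies. *)
  have en : n = q.+2 by lia.
  have ek : k = q.+1 by lia.
  subst n; apply: (compat_id_next cs).
  by have := hodd; rewrite ek => ->; rewrite ?orbT.
have ew' : size w == q.+1 by rewrite ew.
by have := c1 (Tuple ew'); rewrite tuple_act1 /= ofo_uniq.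
Qed.

(** * Too few variables: counterexamples *)

Lemma not_equalizing_small (B : Type) (b0 b1 : B) n k : b0 <> b1 ->
  2 <= n -> n <= k -> ~ equalizing B n k.
Proof.
move=> nb n2 nk eqz; pose A : finType := 'I_k.
have n0 : 0 < n by exact: ltnW.
pose s : 'S_n := tperm (Ordinal n0) (Ordinal n2).
pose a0 : n.-tuple A := [tuple widen_ord nk i | i < n].
pose a1 := tuple_act a0 s.
have a0_inj : injective (tnth a0).
  by move=> x y; rewrite !tnth_mktuple => /(congr1 (@nat_of_ord _)) /= /val_inj.
have ua0 : uniq a0.
  by rewrite map_inj_uniq ?enum_uniq // => x y /(congr1 (@nat_of_ord _)) /= /val_inj.
have ss : (s * s)%g = 1%g by exact: tperm2.
have a1K : tuple_act a1 s = a0 by rewrite tuple_actM ss tuple_act1.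
have a1_inj : injective (tnth a1).
  by move=> x y; rewrite !tnth_mktuple => /(congr1 (@nat_of_ord _)) /= /val_inj /perm_inj.
have ua1 : uniq a1.
  have -> : val a1 = [seq tnth a1 i | i <- enum 'I_n] by rewrite map_tnth_enum.
  by rewrite map_inj_uniq ?enum_uniq.
pose F (c : n.-tuple A) (w : seq A) := if w == c then b1 else b0.
have h : fun_equiv (fun a : n.-tuple A => F a0 (ofo_seq a)) (fun a => F a1 (ofo_seq a)).
  exists s => a; rewrite /F !ofo_eq_uniq //; congr (if _ then _ else _).
  apply/eqP/eqP => [->//|e].
  by rewrite -[a]tuple_act1 -ss -tuple_actM e a1K.
have := eqz A _ _ (card_ord _) (determined_by_ofo_seq _ _) (determined_by_ofo_seq _ _) h a0.
rewrite /F !ofo_eq_uniq // eqxx; case: eqP => [e _|_ /esym //].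
have := congr1 (fun t => tnth t (Ordinal n0)) e.
by rewrite [RHS]tnth_mktuple tpermL => /a0_inj.
Qed.

(** * The sign of a word containing all letters *)

Section SignFunction.
Variable q : nat.

Definition word (d : 'S_q.+1) : q.+1.-tuple 'I_q.+1 := [tuple d i | i < q.+1].

Lemma word_uniq d : uniq (word d).
Proof. by rewrite map_inj_uniq ?enum_uniq //; apply: perm_inj. Qed.

Lemma word_inj : injective word.
Proof.
by move=> d e h; apply/permP=> i; have := congr1 (fun t => tnth t i) h; rewrite !tnth_mktuple.
Qed.

Lemma tuple_act_word d e : tuple_act (word d) e = word (e * d)%g.
Proof. by apply: eq_from_tnth => i; rewrite !tnth_mktuple permM. Qed.

(** For a pair in order, the coordinates of the deleted point [(j, s j)] have opposite parity, since
    [j > 0] is not fixed. Inverted pairs are exchanged neighbours; there the deletion is neutral and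
    the transposition flips the sign. *)
Lemma odd_reduction_tau (s : 'S_q.+2) (i j : 'I_q.+2) :
  is_tau s -> ~~ odd_perm s -> i < j -> odd_perm (reduction i j s).
Proof.
move=> ts es lij; rewrite /reduction; case: (ltngtP (s i) (s j)) => [h|h|/perm_val_inj]; last lia.
  rewrite odd_perm_del (negbTE es) addbF (is_tauE j ts) /tau.
  by have := ltn_ord j; case: ifP; lia.
rewrite odd_perm_del permM tpermR odd_permM (negbTE es) odd_tperm.
have -> : i != j by rewrite -val_eqE /=; lia.
move: h; rewrite (is_tauE i ts) (is_tauE j ts) /tau.
have := ltn_ord j; case: ifP; case: ifP; lia.
Qed.

Definition has_sign (b : bool) (w : seq 'I_q.+1) :=
  [exists d : 'S_q.+1, (odd_perm d == b) && (w == word d)].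

(** With [q.+2] positions for [q.+1] letters some letter repeats, so the action of [s] is seen
    through a reduction. *)
Lemma ofo_tau_word (s : 'S_q.+2) (a : q.+2.-tuple 'I_q.+1) (d : 'S_q.+1) :
  is_tau s -> ~~ odd_perm s -> ofo_seq a = word d ->
  exists2 e : 'S_q.+1, odd_perm e & ofo_seq (tuple_act a s) = word (e * d)%g.
Proof.
move=> ts es ad.
have [i [j [lij e]]] : exists i j : 'I_q.+2, i < j /\ tnth a (s i) = tnth a (s j).
  have [[i j] /andP[/= lij /eqP e]|none] :=
      pickP (fun z : 'I_q.+2 * 'I_q.+2 => (z.1 < z.2) && (tnth a (s z.1) == tnth a (s z.2))).
    by exists i, j.
  suff /leq_card : injective (fun i => tnth a (s i)) by rewrite !card_ord ltnn.
  move=> i j e; apply: val_inj; case: (ltngtP i j) => // lij.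
    by have := none (i, j); rewrite /= lij e eqxx.
  by have := none (j, i); rewrite /= lij e eqxx.
exists (reduction i j s); first exact: odd_reduction_tau.
have [b [ba <-]] := ofo_reduction lij e.
have -> : b = word d by apply/eqP; rewrite -ofo_eq_uniq ?word_uniq // ba ad.
by rewrite tuple_act_word ofo_uniq ?word_uniq.
Qed.

Lemma has_sign_tau (s : 'S_q.+2) (a : q.+2.-tuple 'I_q.+1) b :
  is_tau s -> ~~ odd_perm s ->
  has_sign b (ofo_seq a) -> has_sign (~~ b) (ofo_seq (tuple_act a s)).
Proof.
move=> ts es /existsP[d /andP[/eqP od /eqP ad]].
have [e oe ae] := ofo_tau_word ts es ad.
by apply/existsP; exists (e * d)%g; rewrite odd_permM oe od ae !eqxx.
Qed.

End SignFunction.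

Lemma not_equalizing_next (B : Type) (b0 b1 : B) q : b0 <> b1 ->
  ~~ odd (q.+2)./2 -> ~ equalizing B q.+2 q.+1.
Proof.
move=> nb ev eqz; pose s := tau_perm q.+2.
have ts : is_tau s := is_tau_perm _.
have es : ~~ odd_perm s by rewrite odd_tau.
have ss : (s * s)%g = 1%g.
  by apply/permP=> i; rewrite permM perm1 !permE tau_funK.
pose F b (w : seq 'I_q.+1) := if has_sign b w then b1 else b0.
pose f (b : bool) (a : q.+2.-tuple 'I_q.+1) := F b (ofo_seq a).
have h : fun_equiv (f true) (f false).
  exists s => a; rewrite /f /F; congr (if _ then _ else _).
  apply/idP/idP => [/(has_sign_tau ts es)//|/(has_sign_tau ts es)].
  by rewrite tuple_actM ss tuple_act1.
(* The last index is out of range and [inord] sends it to [0], so all letters occur and only [0] is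
   repeated. *)
pose a : q.+2.-tuple 'I_q.+1 := [tuple inord i | i < q.+2].
have aw : ofo_seq a = word (1%g : 'S_q.+1).
  rewrite -(@ofo_del _ _ ord0 ord_max) //; last first.
    rewrite !tnth_mktuple; transitivity (ord0 : 'I_q.+1).
      by apply: val_inj; rewrite /= inordK.
    by rewrite /inord /insubd insubF //= ltnn.
  have -> : del ord_max a = word 1%g.
    by apply: eq_from_tnth => i; rewrite !tnth_mktuple lift_max inord_val perm1.
  by rewrite ofo_uniq ?word_uniq.
have := eqz 'I_q.+1 _ _ (card_ord _) (determined_by_ofo_seq _ _) (determined_by_ofo_seq _ _) h a.
rewrite /f /F aw.
have -> : has_sign false (word (1%g : 'S_q.+1)).
  by apply/existsP; exists 1%g; rewrite odd_perm1 !eqxx.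
case: ifP => // /existsP[d /andP[/eqP od /eqP/val_inj/word_inj e]].
by move: od; rewrite -e odd_perm1.
Qed.

Theorem theorem7p1 (B : Type) (hB : exists b0 b1 : B, b0 <> b1)
    (n k : nat) (hn : 2 <= n) (hk : 2 <= k) :
  equalizing B n k <->
    ((k = 1 %[mod 4] \/ k = 2 %[mod 4]) /\ k + 1 <= n) \/
    ((k = 0 %[mod 4] \/ k = 3 %[mod 4]) /\ k + 2 <= n).
Proof.
have [b0 [b1 nb]] := hB; split=> [eqz|cond].
  have [nk|kn] := leqP n k; first by case: (not_equalizing_small nb hn nk).
  have [en|nen] := eqVneq n k.+1; last by lia.
  subst n; case: k => // q in hk hn eqz kn *.
  (* With [k = q.+1], the number [(k + 1)./2] is odd exactly when [k] is [1] or [2] modulo [4]. *)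
  have [od|/(not_equalizing_next nb)//] := boolP (odd (q.+2)./2); lia.
by apply: (equalizing_large b0) => // [|en]; lia.
Qed.
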